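(* There is an absolute constant $C\ge1$ such that the following holds. For all positive integers $n,m,r,R,\theta$ with $R\ge r$ and $\theta\ge Cnm\log(2nm)$; all real $\gamma\in[0,1]$; all functions $f\colon\{0,1\}^n\to\{0,1\}$; all probability distributions $\Lambda^*$ on $\{0,1,\dots,R\}^{mn}|_{\le\theta}$; and all positive integers $d$ with \[ d\le\frac1C\min\left\{m\deg_{\pm}(f,\gamma),\ \sqrt r\deg_{\pm}(f,\gamma),\ \frac{\theta}{\sqrt r\log(2nmR)}\right\}, \] there is a probability distribution $\Lambda$ on $\{0,1,\dots,R\}^{mn}|_{\le\theta}$ with \[ \operatorname{orth}((-1)^{f\circ\mathrm{MP}^*_{m,R}}\cdot\Lambda)\ge d\quad\text{and}\quad\Lambda(x)\ge\gamma\cdot(CnmR)^{-9d}\,\Lambda^*(x)\ \text{for all }x. \]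
   Context: For $S\subseteq\mathbb{N}^N$, $S|_{\le\theta}=\{x\in S:\sum_ix_i\le\theta\}$. $\mathrm{MP}^*_{m,R}\colon\{0,1,\dots,R\}^m\to\{0,1\}$ is $\mathrm{MP}^*_{m,R}(t_1,\dots,t_m)=1$ iff $t_i\ge1$ for all $i$; $f\circ\mathrm{MP}^*_{m,R}$ on $(\{0,\dots,R\}^m)^n$ is $(y_1,\dots,y_n)\mapsto f(\mathrm{MP}^*_{m,R}(y_1),\dots,\mathrm{MP}^*_{m,R}(y_n))$. $\operatorname{orth}\phi$ is the minimum total degree of a real polynomial $p$ with $\sum_x\phi(x)p(x)\ne0$ ($\infty$ if none). The $\gamma$-smooth threshold degree $\deg_{\pm}(f,\gamma)$ is the maximum of $\operatorname{orth}((-1)^f\cdot\mu)$ over probability distributions $\mu$ on $\{0,1\}^n$ with $\mu(x)\ge\gamma2^{-n}$ for all $x$. Logarithms base 2. *)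

(* Defs.v *)
From HB Require Import structures.
From mathcomp Require Import all_boot all_order all_algebra.
From mathcomp Require Import all_classical all_reals all_analysis.
(* The notations of [mpoly] clash with those of mathcomp-analysis. *)
From mathcomp Require Import -(notations) mpoly.

Set Implicit Arguments.
Unset Strict Implicit.
Unset Printing Implicit Defensive.

Import Order.TTheory GRing.Theory Num.Theory.
Local Open Scope ring_scope.
Local Open Scope classical_set_scope.

Definition log2 (K : realType) (x : K) : K := ln x / ln 2.

Definition is_distr (K : realType) (X : finType) (mu : X -> K) : Prop :=
  (forall x, 0 <= mu x) /\ \sum_x mu x = 1.

(* [msize p] is one more than the total degree of [p], and 0 for [p = 0];
   the truncated predecessor is harmless since the zero polynomial never
   satisfies the condition in [orth]. *)
Definition tdeg (K : realType) (N : nat) (p : mpoly N K) : nat :=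
  (msize p).-1.

(* The finite type [X] stands for a finite subset of nat^N, the embedding being
   given by [coord]. The infimum is over a set of natural numbers, hence is a
   minimum unless the set is empty, in which case it is +oo. *)
Definition orth (K : realType) (N : nat) (X : finType)
    (coord : X -> 'I_N -> nat) (phi : X -> K) : \bar K :=
  ereal_inf [set ((tdeg p)%:R)%:E | p in
    [set p : mpoly N K |
      \sum_x phi x * meval (fun i => (coord x i)%:R) p != 0]].

Definition cube (n : nat) : finType := {ffun 'I_n -> bool}.

Definition cube_coord (n : nat) (x : cube n) (i : 'I_n) : nat := x i.

(* The supremum is a maximum when 0 <= gamma <= 1: the uniform distribution is
   then admissible, and every value of [orth] below is a natural number at
   most n. *)
Definition smooth_thrdeg (K : realType) (n : nat) (f : cube n -> bool)
    (gamma : K) : \bar K :=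
  ereal_sup [set orth (@cube_coord n) (fun x => (-1) ^+ f x * mu x) | mu in
    [set mu : cube n -> K |
      is_distr mu /\ forall x, gamma * 2 ^- n <= mu x]].

(* {0,...,R}^N restricted to the points of coordinate sum at most theta. *)
Definition trunc_box (N R theta : nat) : finType :=
  {x : {ffun 'I_N -> 'I_R.+1} | (\sum_i x i <= theta)%N}.

Definition trunc_box_coord (N R theta : nat) (x : trunc_box N R theta)
    (i : 'I_N) : nat := val x i.

Definition MPstar (m R : nat) (t : {ffun 'I_m -> 'I_R.+1}) : bool :=
  [forall i, (1 <= t i)%N].

(* The n blocks, each of length m, of a vector of length n * m. *)
Definition block (n m R : nat) (x : {ffun 'I_(n * m) -> 'I_R.+1}) (i : 'I_n) :
    {ffun 'I_m -> 'I_R.+1} :=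
  [ffun j => x (mxvec_index i j)].

Definition comp_MPstar (n m R : nat) (f : cube n -> bool)
    (x : {ffun 'I_(n * m) -> 'I_R.+1}) : bool :=
  f [ffun i => MPstar (block x i)].

(* Main.v *)
(** Let [F] be the composed function and [p] a polynomial of degree less than
    [d] with [(-1)^F p >= -a] on the points of weight at most [theta]. By
    Gordan's alternative it suffices to bound [gamma |p|] by
    [a (C n m R)^(9 d) / 4] there, and to find one point where [p] is small.

    One coordinate: there are laws [l0], with an atom of mass at least 3/5 at 0,
    and [l1], without mass at 0, with the same moments up to order about
    [sqrt r] and exponential moments [E e^(s t) <= 1 + 9 s] for
    [s = 1 / (16 sqrt r)]; they come from a divided difference at the nodes
    0, 1, 4, 64, 64*2^2, 64*3^2, ...  One block: products of these laws,
    corrected at the points without zero coordinate, give laws [L0], [L1] carried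
    exactly by MP* = 0 and MP* = 1 with the same moments up to order about
    [min(m, sqrt r)].  Hence, averaging [p] over the product [L_y] of the laws
    [L_(y_i)] gives a polynomial in [y] of degree less than the smooth threshold
    degree of [f], to which [(-1)^f mu] is orthogonal.

    A polynomial of degree [d] satisfies [|p(x)| <= B E|p|] with
    [B = (C n m R)^d] for every point [x] of the pattern of the law: the point mass
    at [x] is deformed into the law along a curve whose moments of degree [e] are
    polynomials of degree [e] in the parameter, and one extrapolates.  This makes
    the tail [weight > theta] negligible, so that [E_(y ~ mu) E_(L_y) |p| <= 4 a];
    the same inequality, for the uniform mixture of the [L_y], turns the smoothness
    of [mu] into the pointwise bound. *)
Require Import Defs.
From mathcomp Require Import all_boot all_order all_algebra.
From mathcomp Require Import all_classical all_reals all_analysis.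
From mathcomp Require Import -(notations) mpoly.
From mathcomp Require Import ring lra zify.
Set Implicit Arguments.
Unset Strict Implicit.
Unset Printing Implicit Defensive.
Import Order.TTheory GRing.Theory Num.Theory.
Local Open Scope ring_scope.

(** * Deforming point masses *)

Section PolynomialNorm.
Variable K : realFieldType.
Implicit Types (p q : {poly K}) (z : K).

(** For $z\ge0$ this is the $\ell^1$ norm of the coefficients of $p(zX)$. It is submultiplicative,
    hence compatible with products of measures. *)
Definition pnorm z p : K := \sum_(i < size p) `|p`_i| * z ^+ i.

Lemma pnorm_wide z n p : (size p <= n)%N ->
  pnorm z p = \sum_(i < n) `|p`_i| * z ^+ i.
Proof.
move=> le_pn; rewrite /pnorm (big_ord_widen _ (fun i => `|p`_i| * z ^+ i) le_pn).
rewrite big_mkcond /=; apply: eq_bigr => i _.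
by case: ltnP => // /(nth_default 0) ->; rewrite normr0 mul0r.
Qed.

Lemma pnorm_ge0 z p : 0 <= z -> 0 <= pnorm z p.
Proof. by move=> z0; apply: sumr_ge0 => i _; rewrite mulr_ge0 ?exprn_ge0. Qed.

Lemma pnormC z c : pnorm z c%:P = `|c|.
Proof.
rewrite (@pnorm_wide z 1) ?size_polyC_leq1 // big_ord1 coefC eqxx.
by rewrite expr0 mulr1.
Qed.

Lemma pnormX z : pnorm z 'X = z.
Proof.
rewrite (@pnorm_wide z 2) ?size_polyX // big_ord_recr big_ord1 /= !coefX /=.
by rewrite normr0 mul0r add0r normr1 mul1r expr1.
Qed.

Lemma pnormD z p q : 0 <= z -> pnorm z (p + q) <= pnorm z p + pnorm z q.
Proof.
move=> z0; set n := maxn (size p) (size q).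
rewrite (@pnorm_wide z n p) ?leq_maxl // (@pnorm_wide z n q) ?leq_maxr //.
rewrite (@pnorm_wide z n) ?size_polyD // -big_split /=; apply: ler_sum => i _.
by rewrite coefD -mulrDl ler_wpM2r ?exprn_ge0 ?ler_normD.
Qed.

Lemma pnormZ z c p : 0 <= z -> pnorm z (c *: p) <= `|c| * pnorm z p.
Proof.
move=> z0; rewrite (@pnorm_wide z (size p)) ?size_scale_leq // mulr_sumr.
by apply: ler_sum => i _; rewrite coefZ normrM mulrA.
Qed.

Lemma pnormN z p : pnorm z (- p) = pnorm z p.
Proof.
by rewrite /pnorm size_polyN; apply: eq_bigr => i _; rewrite coefN normrN.
Qed.

Lemma pnormMX z p : pnorm z (p * 'X) = pnorm z p * z.
Proof.
rewrite (@pnorm_wide z (size p).+1) ?(leq_trans (size_polyMleq _ _)) //.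
  rewrite big_ord_recl /= coefMX eqxx normr0 mul0r add0r /pnorm mulr_suml.
  by apply: eq_bigr => i _; rewrite coefMX /= exprSr mulrA.
by rewrite size_polyX addn2.
Qed.

Lemma pnormM z p q : 0 <= z -> pnorm z (p * q) <= pnorm z p * pnorm z q.
Proof.
move=> z0; elim/poly_ind: p => [|p c IH].
  by rewrite mul0r /pnorm size_poly0 big_ord0 mul0r.
(* The two summands share no coefficient, so the triangle inequality is an equality here. *)
have -> : pnorm z (p * 'X + c%:P) = pnorm z p * z + `|c|.
  have h : (size (p * 'X + c%:P)%R <= (size p).+1)%N.
    rewrite (leq_trans (size_polyD _ _)) // geq_max.
    rewrite (leq_trans (size_polyMleq _ _)) ?size_polyX ?addn2 //=.
    by rewrite (leq_trans (size_polyC_leq1 _)).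
  rewrite (pnorm_wide z h) big_ord_recl /= coefD coefMX coefC eqxx add0r.
  rewrite expr0 mulr1 addrC; congr (_ + _); rewrite /pnorm mulr_suml.
  by apply: eq_bigr => i _; rewrite coefD coefMX coefC /= addr0 exprSr mulrA.
rewrite mulrDl -mulrA ['X * q]mulrC mulrA mul_polyC.
apply: le_trans (pnormD _ _ z0) _; rewrite pnormMX mulrDl lerD ?pnormZ //.
by rewrite mulrAC ler_wpM2r.
Qed.

Lemma pnorm_prod (I : finType) z (F : I -> {poly K}) : 0 <= z ->
  pnorm z (\prod_i F i) <= \prod_i pnorm z (F i).
Proof.
move=> z0; apply: (big_ind2 (fun p c => pnorm z p <= c)) => //.
- by rewrite -[1%R]/(1%:P) pnormC normr1.
- move=> p a q b pa qb; apply: le_trans (pnormM _ _ z0) _.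
  by apply: ler_pM; rewrite ?pnorm_ge0.
Qed.

Lemma pnorm_sum (I : finType) z (F : I -> {poly K}) : 0 <= z ->
  pnorm z (\sum_i F i) <= \sum_i pnorm z (F i).
Proof.
move=> z0; apply: (big_ind2 (fun p c => pnorm z p <= c)) => //.
- by rewrite /pnorm size_poly0 big_ord0.
- by move=> p a q b pa qb; apply: le_trans (pnormD _ _ z0) _; rewrite lerD.
Qed.

(** For $i\le n$ and $0<z\le1$ one has $1\le z^{-n}z^i$. This is the extrapolation from parameters
    of size $z$ to the parameter 1. *)
Lemma horner1_le_pnorm z n p : 0 < z <= 1 -> (size p <= n.+1)%N ->
  `|p.[1]| <= z ^- n * pnorm z p.
Proof.
move=> /andP[z0 z1] sp; rewrite (horner_coef_wide _ sp) (pnorm_wide z sp).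
apply: le_trans (ler_norm_sum _ _ _) _; rewrite mulr_sumr; apply: ler_sum => i _.
rewrite expr1n mulr1 mulrCA -[leLHS]mulr1 ler_wpM2l //.
have lin : (i <= n)%N by rewrite -ltnS.
rewrite -{1}(subnK lin) exprD invfM -mulrA mulVf ?expf_neq0 ?gt_eqF //.
by rewrite mulr1 invf_ge1 ?exprn_gt0 // exprn_ile1 // ltW.
Qed.

End PolynomialNorm.

(* A finite type [Y] carries an abstract notion of degree through a family [ev]
   of "monomials" [Y -> K] indexed by [W], of degree given by [wd]. *)
Section Tensor.
Variables (K : realFieldType) (Y : finType) (W : Type) (wd : W -> nat).
Variable ev : W -> Y -> K.
Implicit Types (l : Y -> K) (z H : K).

(* A deformation [k] of the point mass at [x] (parameter 1) into the measure [l]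
   (parameter 0): degree-[e] moments have degree [e] in the parameter, so that a
   bound for small parameters extrapolates to the parameter 1. *)
Definition deforms z H (x : Y) l (k : Y -> {poly K}) :=
  [/\ forall y, (k y)`_0 = l y,
      forall y, (k y).[1] = (y == x)%:R,
      forall y, pnorm z (k y) <= H * l y
    & forall w, (size (\sum_y ev w y *: k y)%R <= (wd w).+1)%N].

Variable I : finType.

(** The construction is applied twice, to the coordinates of a block and then to the blocks; the
    index type of the monomials becomes a function type each time. *)
Definition tens (l : I -> Y -> K) (x : {ffun I -> Y}) : K := \prod_i l i (x i).
Definition tens_wd (w : I -> W) : nat := \sum_i wd (w i).
Definition tens_ev (w : I -> W) (x : {ffun I -> Y}) : K :=
  \prod_i ev (w i) (x i).

Lemma tens_pair (l : I -> Y -> K) (w : I -> W) :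
  \sum_x tens l x * tens_ev w x = \prod_i \sum_y l i y * ev (w i) y.
Proof.
by rewrite bigA_distr_bigA; apply: eq_bigr => x _; rewrite /tens -big_split.
Qed.

Lemma tens_total (l : I -> Y -> K) :
  (forall i, \sum_y l i y = 1) -> \sum_x tens l x = 1.
Proof.
by move=> h; rewrite /tens -bigA_distr_bigA; apply: big1 => i _; rewrite h.
Qed.

End Tensor.

Section TensorDeform.
Variables (K : realFieldType) (Y : finType) (W : Type) (wd : W -> nat).
Variable ev : W -> Y -> K.

Lemma deforms_le (z H H' : K) x (l : Y -> K) k :
  (forall y, 0 <= l y) -> H <= H' ->
  deforms wd ev z H x l k -> deforms wd ev z H' x l k.
Proof.
move=> l0 HH [k0 k1 kH ks]; split=> // y.
by apply: le_trans (kH y) _; rewrite ler_wpM2r.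
Qed.

(** The product of the deformations works: the moment of a product monomial factors, so degrees add
    up, and [pnorm] is submultiplicative. *)
Lemma deforms_tens (I : finType) (z : K) (H : I -> K) (x : {ffun I -> Y})
    (l : I -> Y -> K) : 0 <= z ->
  (forall i, exists k, deforms wd ev z (H i) (x i) (l i) k) ->
  exists k, deforms (@tens_wd W wd I) (@tens_ev K Y W ev I) z (\prod_i H i) x
    (tens l) k.
Proof.
move=> z0 /fin_all_exists[k kP].
exists (fun y : {ffun I -> Y} => \prod_i k i (y i)); split.
- by move=> y; rewrite coef0_prod; apply: eq_bigr => i _; case: (kP i).
- move=> y; rewrite horner_prod; have [->|ne] := eqVneq y x.
    by apply: big1 => i _; case: (kP i) => _ -> _ _; rewrite eqxx.
  have [i ne_i] : exists i, y i != x i.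
    apply/existsP; apply: contraNT ne; rewrite negb_exists => /forallP h.
    by apply/eqP/ffunP => i; apply/eqP/negbNE.
  by rewrite (bigD1 i) //=; case: (kP i) => _ -> _ _; rewrite (negPf ne_i) mul0r.
- move=> y; apply: le_trans (pnorm_prod _ z0) _.
  rewrite /tens -big_split /=; apply: ler_prod => i _.
  by rewrite pnorm_ge0 //=; case: (kP i).
move=> w; have -> : \sum_(y : {ffun I -> Y}) tens_ev ev w y *: \prod_i k i (y i) =
    \prod_i \sum_y ev (w i) y *: k i y.
  rewrite bigA_distr_bigA; apply: eq_bigr => y _.
  by rewrite /tens_ev -scaler_prod.
rewrite (leq_trans (size_poly_prod_leq _ _)) // leq_subLR addnS ltnS.
rewrite (_ : #|_| = (\sum_(i : I) 1)%N); last by rewrite sum1_card.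
rewrite /tens_wd -big_split /=.
by apply: leq_sum => i _; case: (kP i) => _ _ _ /(_ (w i)).
Qed.

(** The segment from [b] to [l] is superposed on the given deformation: $b(1-X)+lX+(k-l)$ is $b$ at
    0 and the point mass at 1. The linear terms are harmless for moments of positive degree and
    cancel in degree 0, both masses being 1. *)
Lemma deforms_rebase (z H c : K) x (l b : Y -> K) k :
  0 <= z -> 1 <= c ->
  (forall y, 0 <= b y) -> (forall y, l y <= c * b y) -> (forall y, 0 <= l y) ->
  1 <= H ->
  \sum_y l y = 1 -> \sum_y b y = 1 ->
  (forall w, wd w = 0%N -> forall y, ev w y = 1) ->
  deforms wd ev z H x l k ->
  exists k', deforms wd ev z (1 + (1 + c) * z + c * (H - 1)) x b k'.
Proof.
move=> z0 c1 b0 lb l0 H1 l1 b1 ev1 [k0 k1 kH ks].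
exists (fun y => b y *: (1 - 'X) + l y *: 'X + (k y - (l y)%:P)); split.
- move=> y; rewrite !(coefD, coefZ, coefN, coefC, coefX, coef1) k0 /=; ring.
- move=> y; rewrite !hornerE k1 /=; ring.
- move=> y; have hl : pnorm z (k y - (l y)%:P) <= (H - 1) * l y.
    (* Subtracting [l y] removes exactly the constant coefficient. Hence $H-1$, and not $H$, is
       multiplied by $c$, which keeps the new bound close to 1. *)
    have -> : pnorm z (k y - (l y)%:P) = pnorm z (k y) - l y.
      set n := maxn (size (k y)) 1.
      have sk : (size (k y) <= n)%N by rewrite leq_maxl.
      have skl : (size (k y - (l y)%:P)%R <= n)%N.
        rewrite (leq_trans (size_polyD _ _)) // geq_max sk size_polyN.
        by rewrite (leq_trans (size_polyC_leq1 _)) ?leq_maxr.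
      have : (0 < n)%N by rewrite leq_maxr.
      rewrite (pnorm_wide z sk) (pnorm_wide z skl); case: n {sk skl} => // n _.
      rewrite !big_ord_recl /= coefB coefC eqxx k0 subrr normr0 mul0r.
      rewrite add0r ger0_norm // expr0 mulr1 [RHS]addrAC subrr add0r.
      by apply: eq_bigr => i _; rewrite coefB coefC subr0.
    by rewrite mulrBl mul1r lerB.
  apply: le_trans (pnormD _ _ z0) _; apply: (@le_trans _ _
    (b y * (1 + z) + l y * z + (H - 1) * l y)).
    rewrite lerD //; apply: le_trans (pnormD _ _ z0) _; apply: lerD.
      apply: le_trans (pnormZ _ _ z0) _; rewrite ger0_norm // ler_wpM2l //.
      apply: le_trans (pnormD _ _ z0) _.
      by rewrite pnormN pnormX -[1%R]/(1%:P) pnormC normr1.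
    by apply: le_trans (pnormZ _ _ z0) _; rewrite ger0_norm // pnormX.
  have := lb y; have H0 : 0 <= H - 1 by rewrite subr_ge0.
  move=> h; have h1 : l y * z <= c * b y * z by rewrite ler_wpM2r.
  have h2 : (H - 1) * l y <= (H - 1) * (c * b y) by rewrite ler_wpM2l.
  nra.
move=> w; under eq_bigr do rewrite scalerDr.
have [w0|w0] := posnP (wd w).
  rewrite (eq_bigr (fun y => (1 - 'X) * (b y)%:P + (l y)%:P * 'X +
     (ev w y *: k y - (l y)%:P))); last first.
    move=> y _; rewrite ev1 // !scale1r -!mul_polyC; ring.
  rewrite big_split /= sumrB big_split /= -mulr_sumr -mulr_suml -!rmorph_sum /=.
  rewrite l1 b1 mulr1 mul1r subrK addrCA subrr addr0.
  exact: ks.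
rewrite big_split /=; apply: leq_trans (size_polyD _ _) _; rewrite geq_max.
apply/andP; split.
  apply: leq_trans (size_sum _ _ _) _; apply/bigmax_leqP => y _.
  apply: leq_trans (size_scale_leq _ _) _; rewrite -!mul_polyC.
  apply: leq_trans (size_polyD _ _) _; rewrite geq_max !mul_polyC.
  rewrite !(leq_trans (size_scale_leq _ _)) ?size_polyX //.
  by rewrite (leq_trans (size_polyD _ _)) // geq_max size_polyN size_polyX size_poly1.
under eq_bigr do rewrite scalerBr.
rewrite sumrB; apply: leq_trans (size_polyD _ _) _; rewrite geq_max ks size_polyN.
apply: leq_trans (size_sum _ _ _) _; apply/bigmax_leqP => y _.
by rewrite (leq_trans (size_scale_leq _ _)) // (leq_trans (size_polyC_leq1 _)).
Qed.

(** The polynomial $Q=\sum_y p(y)k_y$ satisfies $Q(1)=p(x)$, has degree at most $d$, and its norm is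
    at most $H\sum_y l(y)|p(y)|$; it remains to extrapolate. *)
Lemma deforms_bound (z H : K) x (l : Y -> K) k (d : nat) (J : finType)
    (c : J -> K) (w : J -> W) (p : Y -> K) :
  0 < z <= 1 ->
  (forall y, p y = \sum_j c j * ev (w j) y) ->
  (forall j, (wd (w j) <= d)%N) ->
  deforms wd ev z H x l k ->
  `|p x| <= z ^- d * H * \sum_y l y * `|p y|.
Proof.
move=> zz pE wd_d [k0 k1 kH ks]; have /andP[z0 _] := zz.
pose Q := \sum_y p y *: k y.
have Q1 : Q.[1] = p x.
  rewrite horner_sum (bigD1 x) //= big1 ?addr0 ?hornerZ ?k1 ?eqxx ?mulr1 //.
  by move=> y /negPf yx; rewrite hornerZ k1 yx mulr0.
have sQ : (size Q <= d.+1)%N.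
  have -> : Q = \sum_j c j *: \sum_y ev (w j) y *: k y.
    under [RHS]eq_bigr do rewrite scaler_sumr.
    rewrite exchange_big /=; apply: eq_bigr => y _; rewrite pE scaler_suml.
    by apply: eq_bigr => j _; rewrite scalerA.
  apply: leq_trans (size_sum _ _ _) _; apply/bigmax_leqP => j _.
  by rewrite (leq_trans (size_scale_leq _ _)) // (leq_trans (ks _)) // ltnS.
rewrite -Q1; apply: le_trans (horner1_le_pnorm zz sQ) _; rewrite /Q.
rewrite -mulrA ler_wpM2l ?invr_ge0 ?exprn_ge0 ?(ltW z0) //.
apply: le_trans (pnorm_sum _ (ltW z0)) _; rewrite mulr_sumr; apply: ler_sum => y _.
apply: (le_trans (pnormZ (p y) (k y) (ltW z0))); rewrite mulrA [leRHS]mulrC.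
by rewrite ler_wpM2l.
Qed.

End TensorDeform.

Lemma expr1D_le (K : realFieldType) (x : K) (m : nat) :
  0 <= x -> 2 * m%:R * x <= 1 -> (1 + x) ^+ m <= 1 + 2 * m%:R * x.
Proof.
move=> x0; elim: m => [|m IH] hm; first by rewrite expr0 mulr0 mul0r addr0.
have m0 : 0 <= m%:R :> K by [].
have e : m.+1%:R = m%:R + 1 :> K by rewrite -natr1.
rewrite e in hm *; have {}IH : (1 + x) ^+ m <= 1 + 2 * m%:R * x by apply: IH; nra.
rewrite exprS; apply: (@le_trans _ _ ((1 + x) * (1 + 2 * m%:R * x))).
  by rewrite ler_wpM2l // addr_ge0.
nra.
Qed.

(** * Binomial laws as polynomials in the success probability *)

Section BinomialLaw.
Variable K : realFieldType.

(* The probability that a binomial variable with parameters [(N, 'X)] equals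
   [l], as a polynomial in the success probability. *)
Fixpoint binlaw (N l : nat) : {poly K} :=
  if N is N'.+1 then
    (1 - 'X) * binlaw N' l + 'X * (if l is l'.+1 then binlaw N' l' else 0)
  else (l == 0%N)%:R%:P.

Lemma binlaw_gt N l : (N < l)%N -> binlaw N l = 0.
Proof.
elim: N l => [|N IH] [|l] //= h.
by rewrite !IH ?mulr0 ?addr0 // ltnW.
Qed.

Lemma binlaw_horner1 N l : (binlaw N l).[1] = (l == N)%:R.
Proof.
elim: N l => [|N IH] l /=; first by rewrite hornerC.
rewrite !(hornerM, hornerD, hornerN, hornerX) -[1%R in X in X * _]/(1%:P) hornerC.
by rewrite subrr mul0r add0r mul1r; case: l => [|l]; rewrite ?horner0 ?IH.
Qed.

Lemma binlaw_coef0 N l : (binlaw N l)`_0 = (l == 0%N)%:R.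
Proof.
elim: N l => [|N IH] l /=; first by rewrite coefC.
by rewrite coefD !coef0M coefB coef1 coefX subr0 mul1r mul0r addr0 IH.
Qed.

Lemma pnorm_1BX (z : K) : 0 <= z -> pnorm z (1 - 'X) <= 1 + z.
Proof.
move=> z0; apply: le_trans (pnormD _ _ z0) _.
by rewrite pnormN pnormX -[1%R]/(1%:P) pnormC normr1.
Qed.

(** In closed form the law is $\binom Nl X^l(1-X)^{N-l}$, and $\binom Nl\le N^l$; the recursion
    gives the bound directly. *)
Lemma pnorm_binlaw (z : K) N l : 0 <= z ->
  pnorm z (binlaw N l) <= (N%:R * z) ^+ l * (1 + z) ^+ N.
Proof.
move=> z0; have z10 : 0 <= 1 + z by rewrite addr_ge0.
elim: N l => [|N IH] l /=.
  by rewrite pnormC normr_nat mul0r expr0 mulr1 expr0n.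
apply: le_trans (pnormD _ _ z0) _.
apply: (@le_trans _ _ ((1 + z) * ((N%:R * z) ^+ l * (1 + z) ^+ N) +
   z * (if l is l'.+1 then (N%:R * z) ^+ l' * (1 + z) ^+ N else 0))).
  apply: lerD; apply: le_trans (pnormM _ _ z0) _.
    by apply: ler_pM; rewrite ?pnorm_ge0 ?pnorm_1BX.
  rewrite pnormX ler_wpM2l //; case: l => [|l] //.
  by rewrite -polyC0 pnormC normr0.
have Nz0 : 0 <= N%:R * z by rewrite mulr_ge0.
have Nz1 : N%:R * z <= N.+1%:R * z by rewrite ler_wpM2r // ler_nat.
case: l => [|l]; first by rewrite !expr0 mulr0 addr0 !mul1r exprS.
rewrite mulrCA !mulrA -mulrA -exprS.
apply: (@le_trans _ _ ((N%:R * z) ^+ l.+1 * (1 + z) ^+ N.+1 +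
   (N%:R * z) ^+ l * z * (1 + z) ^+ N.+1)).
  rewrite lerD2l [z * _]mulrC ler_wpM2l ?mulr_ge0 ?exprn_ge0 //.
  by rewrite exprS ler_peMl ?exprn_ge0 // lerDl.
rewrite -mulrDl ler_wpM2r ?exprn_ge0 // exprSr -mulrDr [leRHS]exprSr.
apply: ler_pM; rewrite ?exprn_ge0 ?addr_ge0 ?mulr_ge0 //.
  by rewrite lerXn2r ?nnegrE ?mulr_ge0.
by rewrite -natr1 mulrDl mul1r.
Qed.

Lemma pnorm_binlaw0B1 (z : K) N : 0 <= z ->
  pnorm z (binlaw N 0 - 1) <= (1 + z) ^+ N - 1.
Proof.
move=> z0; elim: N => [|N IH] /=.
  by rewrite subrr expr0 subrr -polyC0 pnormC normr0.
have -> : (1 - 'X) * binlaw N 0 + 'X * 0 - 1 =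
    (1 - 'X) * (binlaw N 0 - 1) - 'X :> {poly K} by ring.
apply: le_trans (pnormD _ _ z0) _; rewrite pnormN pnormX.
have -> : (1 + z) ^+ N.+1 - 1 = (1 + z) * ((1 + z) ^+ N - 1) + z.
  by rewrite exprS; ring.
rewrite lerD2r; apply: le_trans (pnormM _ _ z0) _.
by apply: ler_pM; rewrite ?pnorm_ge0 ?pnorm_1BX.
Qed.

(** Conditioning on one trial gives $E\,q(S_{N+1})=E\,q(S_N)+X\,E\,(\Delta q)(S_N)$ with $\Delta
    q(t)=q(t+1)-q(t)$ of smaller degree, so the mean of $q$ has degree at most that of $q$. *)
Lemma size_binlaw_moment N M (q : {poly K}) : (N < M)%N ->
  (size (\sum_(l < M) q.[l%:R] *: binlaw N l)%R <= size q)%N.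
Proof.
elim: N M q => [|N IH] [|M] // q hM.
  rewrite big_ord_recl big1 ?addr0 /=; last first.
    by move=> i _; rewrite /= mulr0n polyC0 scaler0.
  have [->|q0] := eqVneq q 0; first by rewrite horner0 scale0r.
  rewrite (leq_trans (size_scale_leq _ _)) // (leq_trans (size_polyC_leq1 _)) //.
  by rewrite size_poly_gt0.
pose D := q \Po ('X + 1%:P) - q.
have -> : \sum_(l < M.+1) q.[l%:R] *: binlaw N.+1 l =
    \sum_(l < M.+1) q.[l%:R] *: binlaw N l
    + 'X * \sum_(l < M) D.[l%:R] *: binlaw N l.
  transitivity ((1 - 'X) * (\sum_(l < M.+1) q.[l%:R] *: binlaw N l) +
    'X * (\sum_(l < M) (q \Po ('X + 1%:P)).[l%:R] *: binlaw N l)).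
    rewrite 2!mulr_sumr [X in _ = _ + X](_ : _ = \sum_(l < M.+1) q.[l%:R] *:
        ('X * (if (l : nat) is l'.+1 then binlaw N l' else 0))); last first.
      rewrite [RHS]big_ord_recl /= mulr0 scaler0 add0r; apply: eq_bigr => l _.
      by rewrite horner_comp hornerD hornerX hornerC natr1 scalerAr.
    rewrite -big_split /=; apply: eq_bigr => l _.
    by rewrite -scalerAr -scalerDr.
  have -> : \sum_(l < M) D.[l%:R] *: binlaw N l =
      \sum_(l < M) (q \Po ('X + 1%:P)).[l%:R] *: binlaw N l
      - \sum_(l < M) q.[l%:R] *: binlaw N l.
    by rewrite -sumrB; apply: eq_bigr => l _; rewrite hornerD hornerN scalerBl.
  have -> : \sum_(l < M.+1) q.[l%:R] *: binlaw N l =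
      \sum_(l < M) q.[l%:R] *: binlaw N l.
    by rewrite big_ord_recr /= binlaw_gt ?scaler0 ?addr0.
  by ring.
apply: leq_trans (size_polyD _ _) _; rewrite geq_max (IH _ _ (ltnW hM)) /=.
have [q0|q0] := eqVneq q 0.
  rewrite big1 ?mulr0 ?size_poly0 // => l _.
  by rewrite /D q0 comp_poly0 subrr horner0 scale0r.
(* The shift preserves the leading coefficient, which cancels in the difference. *)
have sD : (size D < size q)%N.
  have sq : (0 < size q)%N by rewrite size_poly_gt0.
  have sq' : size (q \Po ('X + 1%:P)) = size q.
    by apply: size_comp_poly2; rewrite size_XaddC.
  have le : (size D <= size q)%N.
    by rewrite (leq_trans (size_polyD _ _)) // geq_max size_polyN sq' leqnn.
  rewrite -(prednK sq) ltnS; apply/leq_sizeP => j hj.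
  have [->|ne] := eqVneq j (size q).-1; last first.
    apply: nth_default; apply: leq_trans le _; rewrite -(prednK sq).
    by rewrite ltn_neqAle eq_sym ne.
  have s2 : (1 < size ('X + 1%:P : {poly K})%R)%N by rewrite size_XaddC.
  have := lead_coef_comp q s2; rewrite coefB lead_coefXaddC expr1n mulr1.
  by rewrite /lead_coef sq' => ->; rewrite subrr.
apply: leq_trans (size_polyMleq _ _) _; rewrite size_polyX /=.
by apply: leq_ltn_trans sD; apply: IH.
Qed.

End BinomialLaw.

(** * Deformations for one coordinate *)

Section Coordinate.
Variables (K : realFieldType) (R : nat).
Local Notation T := 'I_R.+1.

Definition coord_ev (e : nat) (t : T) : K := (t : nat)%:R ^+ e.
Local Notation wd := (fun e : nat => e).

(** Let $\nu$ be the law of $1+\mathrm{Bin}(t-1,X)$, which moves from $\delta_1$ to $\delta_t$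
    without charging 0. The deformation is $l(1-X)+\delta_1X+(\nu-\delta_1)$; the lower bound on $l$
    pays for the coefficients of $\nu$. *)
Lemma coord_deforms_pos (z : K) (t : T) (l : T -> K) :
  0 <= z -> 8 * R%:R * z <= 1 -> (0 < t)%N ->
  (forall y, 0 <= l y) -> \sum_y l y = 1 ->
  (forall y : T, (0 < y)%N -> 8 ^- y / 2 <= l y) ->
  exists k, deforms wd coord_ev z (1 + 257 * R%:R * z) t l k.
Proof.
move=> z0 Rz t0 l0 l1 ll.
have R1 : 1 <= R%:R :> K by rewrite ler1n (leq_trans t0) // -ltnS.
set N := t.-1.
have tN : t = N.+1 :> nat by rewrite prednK.
have NR : (N < R)%N by rewrite -ltnS -tN.
pose nu (y : T) : {poly K} := if (y : nat) is l'.+1 then binlaw K N l' else 0.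
exists (fun y => l y *: (1 - 'X) + (((y : nat) == 1%N)%:R *: 'X +
   (nu y - ((y : nat) == 1%N)%:R%:P))); split.
- move=> y; rewrite !(coefD, coefZ, coefN, coefC, coefX, coef1) /nu /=.
  by case: (y : nat) => [|l'] /=; rewrite ?coef0 ?binlaw_coef0; ring.
- move=> y; rewrite !hornerE /nu /= -(inj_eq val_inj) /= tN.
  by case: (y : nat) => [|l'] /=; rewrite ?horner0 ?binlaw_horner1 ?eqSS; ring.
- move=> y; have R0 : 0 <= R%:R :> K by [].
  have z1 : z <= 1 by nra.
  apply: le_trans (pnormD _ _ z0) _.
  have -> : (1 + 257 * R%:R * z) * l y = l y * (1 + z) +
     ((257 * R%:R - 1) * z) * l y by ring.
  apply: lerD.
    apply: le_trans (pnormZ _ _ z0) _.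
    by rewrite ger0_norm // ler_wpM2l // pnorm_1BX.
  have pow2 : (1 + z) ^+ N <= 1 + 2 * (R%:R * z).
    have NR' : N%:R <= R%:R :> K by rewrite ler_nat ltnW.
    have NRz : N%:R * z <= R%:R * z by rewrite ler_wpM2r.
    apply: (@le_trans _ _ (1 + 2 * N%:R * z)); first by apply: expr1D_le => //; lra.
    by lra.
  rewrite /nu; case Ey: (y : nat) => [|[|l']] /=.
  + rewrite subr0 addr0 scale0r -polyC0 pnormC normr0.
    by apply: mulr_ge0 (l0 y); apply: mulr_ge0 z0; rewrite subr_ge0; lra.
  + have := ll y; rewrite Ey => /(_ isT); rewrite expr1 => ly.
    apply: (@le_trans _ _ (z + 2 * (R%:R * z))); last first.
      have ly' : 16^-1 <= l y by lra.
      have c0 : 0 <= (257 * R%:R - 1) * z.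
        by apply: mulr_ge0 z0; rewrite subr_ge0; lra.
      have zR : z <= R%:R * z by rewrite ler_peMl.
      by have := ler_wpM2l c0 ly'; lra.
    rewrite scale1r; apply: le_trans (pnormD _ _ z0) _; rewrite pnormX lerD2l.
    by apply: le_trans (pnorm_binlaw0B1 N z0) _; rewrite lerBlDr [leRHS]addrC.
  have := ll y; rewrite Ey => /(_ isT) ly.
  rewrite subr0 scale0r add0r; apply: le_trans (pnorm_binlaw _ _ z0) _.
  (* With $y=l'+2$, all but one of the factors $Rz$ are replaced by $1/8$. Comparing
     $2\cdot8^{-l'}Rz$ with $l(y)\ge8^{-l'}/128$ costs $256Rz$; the remaining part of $257Rz$ covers
     the norm of $1-X$. *)
  apply: (@le_trans _ _ ((8^-1) ^+ l' * (R%:R * z) * 2)).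
    rewrite -mulrA; apply: (@le_trans _ _ ((R%:R * z) ^+ l'.+1 * 2)).
      apply: ler_pM; rewrite ?exprn_ge0 ?mulr_ge0 ?addr_ge0 //.
        by rewrite lerXn2r ?nnegrE ?mulr_ge0 // ler_wpM2r // ler_nat ltnW.
      by apply: le_trans pow2 _; nra.
    rewrite exprSr -mulrA ler_wpM2r ?mulr_ge0 //.
    rewrite lerXn2r ?nnegrE ?mulr_ge0 ?invr_ge0 //.
    by rewrite -[8^-1]mul1r ler_pdivlMr //; nra.
  have e8 : 8 ^- l'.+2 = (8^-1) ^+ l' / 64 :> K.
    by rewrite -exprVn !exprSr -mulrA -invfM; congr (_ * _^-1); ring.
  rewrite e8 in ly; set g := 8^-1 ^+ l' in ly *.
  have g0 : 0 <= g by rewrite exprn_ge0 ?invr_ge0.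
  have h1 : g <= 128 * l y by nra.
  have Rz0 : 0 <= R%:R * z * 2 by rewrite !mulr_ge0.
  have Rzl : 0 <= (R%:R - 1) * z * l y by rewrite !mulr_ge0 ?subr_ge0.
  by have := ler_wpM2r Rz0 h1; lra.
move=> e; have nuE : \sum_y coord_ev e y *: nu y =
    \sum_(j < R) ((('X + 1%:P) ^+ e).[j%:R]) *: binlaw K N j.
  rewrite big_ord_recl /= {1}/nu /= scaler0 add0r; apply: eq_bigr => j _.
  by rewrite /nu /= /coord_ev /= horner_exp hornerD hornerX hornerC natr1.
have snu : (size (\sum_y coord_ev e y *: nu y)%R <= e.+1)%N.
  rewrite nuE; apply: leq_trans (size_binlaw_moment _ NR) _.
  by rewrite (leq_trans (size_poly_exp_leq _ _)) // size_XaddC mul1n.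
pose o1 : T := inord 1.
have o1E : (o1 : nat) = 1%N by rewrite inordK // ltnS; apply: leq_trans NR.
have -> : \sum_y coord_ev e y *: (l y *: (1 - 'X) + (((y : nat) == 1%N)%:R *: 'X
      + (nu y - ((y : nat) == 1%N)%:R%:P))) =
    (\sum_y coord_ev e y * l y) *: (1 - 'X) + ('X - 1) + \sum_y coord_ev e y *: nu y.
  have -> : 'X - 1 = \sum_(y : T) coord_ev e y * ((y : nat) == 1%N)%:R *: ('X - 1)
      :> {poly K}.
    rewrite (bigD1 o1) //= big1 ?addr0.
      by rewrite /coord_ev o1E eqxx expr1n mul1r scale1r.
    move=> y ne; case: eqP => [e1|]; last by rewrite mulr0 scale0r.
    by case/eqP: ne; apply: val_inj; rewrite /= o1E.
  rewrite scaler_suml -!big_split /=; apply: eq_bigr => y _.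
  by rewrite -!mul_polyC !polyCM; ring.
case: e nuE snu => [|e] nuE snu.
  rewrite (eq_bigr l) ?l1 => [|y _]; last by rewrite /coord_ev expr0 mul1r.
  by rewrite scale1r addrA subrK subrr add0r.
apply: leq_trans (size_polyD _ _) _; rewrite geq_max snu andbT.
apply: leq_trans (size_polyD _ _) _; rewrite geq_max; apply/andP; split.
  rewrite (leq_trans (size_scale_leq _ _)) // (leq_trans (size_polyD _ _)) //.
  by rewrite geq_max size_polyN size_polyX size_poly1.
by rewrite (leq_trans (size_polyD _ _)) // geq_max size_polyN size_polyX size_poly1.
Qed.

(** An atom of mass at least $1/c$ at $t$ dominates the point mass, so the segment from $l$ to
    $\delta_t$ suffices. This serves the point 0. *)
Lemma coord_deforms_dom (z c : K) (t : T) (l : T -> K) :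
  0 <= z -> 0 <= c ->
  (forall y, 0 <= l y) -> \sum_y l y = 1 -> 1 <= c * l t ->
  exists k, deforms wd coord_ev z (1 + (1 + c) * z) t l k.
Proof.
move=> z0 c0 l0 l1 lt.
exists (fun y => l y *: (1 - 'X) + (y == t)%:R *: 'X); split.
- move=> y; rewrite !(coefD, coefZ, coefN, coefC, coefX, coef1) /=; ring.
- move=> y; rewrite !hornerE /=; ring.
- move=> y; apply: le_trans (pnormD _ _ z0) _.
  have -> : (1 + (1 + c) * z) * l y = l y * (1 + z) + c * l y * z by ring.
  apply: lerD.
    apply: le_trans (pnormZ _ _ z0) _.
    by rewrite ger0_norm // ler_wpM2l // pnorm_1BX.
  apply: le_trans (pnormZ _ _ z0) _; rewrite pnormX ler_wpM2r // normr_nat.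
  by have [->|_] := eqVneq y t; rewrite // mulr_ge0.
move=> e; under eq_bigr do rewrite scalerDr.
case: e => [|e].
  under eq_bigr do rewrite /coord_ev expr0 !scale1r.
  rewrite big_split /= -!scaler_suml l1 scale1r (bigD1 t) //= big1 ?addr0.
    by rewrite eqxx scale1r subrK size_poly1.
  by move=> y /negPf ->.
apply: leq_trans (size_sum _ _ _) _; apply/bigmax_leqP => y _.
apply: leq_trans (size_polyD _ _) _; rewrite geq_max.
rewrite !(leq_trans (size_scale_leq _ _)) ?size_polyX //.
by rewrite (leq_trans (size_polyD _ _)) // geq_max size_polyN size_polyX size_poly1.
Qed.

Lemma coord_deforms_delta (z : K) (t : T) :
  exists k, deforms wd coord_ev z 1 t (fun y => (y == t)%:R) k.
Proof.
exists (fun y => (y == t)%:R%:P); split=> [y|y|y|e].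
- by rewrite coefC.
- by rewrite hornerC.
- by rewrite pnormC normr_nat mul1r.
apply: leq_trans (size_sum _ _ _) _; apply/bigmax_leqP => y _.
by rewrite (leq_trans (size_scale_leq _ _)) // (leq_trans (size_polyC_leq1 _)).
Qed.

End Coordinate.

(** * Laws on one block and anticoncentration *)

Section Block.
Variables (K : realFieldType) (R m : nat) (l0 l1 : 'I_R.+1 -> K).
Local Notation T := 'I_R.+1.
Local Notation X := {ffun 'I_m -> T}.
Local Notation MP x := [forall i, (1 <= x i)%N].
Hypotheses (m_gt0 : (0 < m)%N) (R_gt0 : (0 < R)%N).
Hypotheses (l0_ge0 : forall t, 0 <= l0 t) (l1_ge0 : forall t, 0 <= l1 t).
Hypotheses (l0_sum : \sum_t l0 t = 1) (l1_sum : \sum_t l1 t = 1).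
Hypotheses (l1_0 : l1 ord0 = 0) (l0_0 : 3 / 5 <= l0 ord0).
Hypothesis l0_low : forall t : T, (0 < t)%N -> 8 ^- t / 2 <= l0 t.
Hypothesis l1_low : forall t : T, (0 < t)%N -> 8 ^- t / 2 <= l1 t.

(** The total mass is 0, so the product of $m$ copies kills every monomial that omits a variable. *)
Definition signed0 (t : T) : K := if t == ord0 then l0 ord0 - 1 else l0 t.

(* [tens signed0] agrees with [tens l0] at the points without zero coordinate
   and is orthogonal to all polynomials of degree less than [m]. *)
Definition block_law (b : bool) (x : X) : K :=
  if b then tens (fun _ => l1) x
  else tens (fun _ => l0) x - tens (fun _ => signed0) x.

Lemma tens_ge0 (I Y : finType) (l : I -> Y -> K) x :
  (forall i y, 0 <= l i y) -> 0 <= tens l x.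
Proof. by move=> h; apply: prodr_ge0 => i _. Qed.

Lemma l0_0_le1 : l0 ord0 <= 1.
Proof. by rewrite -l0_sum (bigD1 ord0) //= lerDl sumr_ge0. Qed.

Lemma signed0_sum : \sum_t signed0 t = 0.
Proof.
rewrite (bigD1 ord0) //= {1}/signed0 eqxx.
rewrite (eq_bigr l0) => [|t /negPf h]; last by rewrite /signed0 h.
by move: l0_sum; rewrite (bigD1 ord0) //= => h; rewrite addrAC h subrr.
Qed.

Lemma norm_signed0 t : `|signed0 t| <= l0 t.
Proof.
rewrite /signed0; case: eqP => [->|_]; last by rewrite ger0_norm.
have := l0_0_le1; have := l0_0 => h h'.
by rewrite ler0_norm ?subr_le0 // opprB; lra.
Qed.

Lemma notMP (x : X) : ~~ MP x -> exists j, x j = ord0.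
Proof.
rewrite negb_forall => /existsP[j]; rewrite -eqn0Ngt => /eqP h.
by exists j; apply: val_inj.
Qed.

(** The factor at a zero coordinate is $1-l_0(0)\le\frac23l_0(0)$, which is where $l_0(0)\ge3/5$
    enters; the other factors are at most those of [l0]. *)
Lemma norm_tens_signed0 (x : X) : ~~ MP x ->
  `|tens (fun _ => signed0) x| <= 2 / 3 * tens (fun _ => l0) x.
Proof.
move=> /notMP[j xj]; rewrite /tens normr_prod (bigD1 j) //= [in leRHS](bigD1 j) //=.
rewrite mulrA; apply: ler_pM => //; first by rewrite prodr_ge0.
  rewrite xj /signed0 eqxx ler0_norm ?subr_le0 ?l0_0_le1 // opprB.
  by have := l0_0 => h; lra.
by apply: ler_prod => i _; rewrite normr_ge0 norm_signed0.
Qed.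

Lemma block_law_off b (x : X) : b != MP x -> block_law b x = 0.
Proof.
case: b => /=; case: (boolP (MP x)) => // h _.
  have [j xj] := notMP h.
  by rewrite /tens (bigD1 j) //= xj l1_0 mul0r.
apply/eqP; rewrite subr_eq0; apply/eqP/eq_bigr => i _; rewrite /signed0.
by case: eqP => // xi; have := forallP h i; rewrite xi.
Qed.

Lemma block_law_false_ge (x : X) : ~~ MP x ->
  tens (fun _ => l0) x <= 3 * block_law false x.
Proof.
move=> /norm_tens_signed0; rewrite /block_law.
set c := tens (fun _ => signed0) x => h.
by have := ler_norm c; lra.
Qed.

Lemma block_law_false_le (x : X) : block_law false x <= 2 * tens (fun _ => l0) x.
Proof.
have t0 : 0 <= tens (fun _ : 'I_m => l0) x by apply: tens_ge0.
have [h|h] := boolP (MP x).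
  by rewrite block_law_off ?h // mulr_ge0.
have := norm_tens_signed0 h; rewrite /block_law.
set c := tens (fun _ => signed0) x => h'.
by have := lerNnormlW (lexx `|c|); lra.
Qed.

Lemma block_law_ge0 b (x : X) : 0 <= block_law b x.
Proof.
have [h|h] := eqVneq b (MP x); last by rewrite block_law_off.
case: b h => h; first by apply: tens_ge0.
have t0 : 0 <= tens (fun _ : 'I_m => l0) x by apply: tens_ge0.
have : ~~ MP x by rewrite -h.
by move/block_law_false_ge => h'; lra.
Qed.

Lemma block_law_sum b : \sum_x block_law b x = 1.
Proof.
case: b => /=; first by rewrite tens_total.
rewrite sumrB tens_total // {1}/tens -(bigA_distr_bigA (fun _ => signed0)).
by rewrite (bigD1 (Ordinal m_gt0)) //= signed0_sum mul0r subr0.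
Qed.

Definition block_ev := @tens_ev K T nat (@coord_ev K R) 'I_m.
Definition block_wd := @tens_wd nat (fun e => e) 'I_m.

(** Degree less than $m$ forces a zero exponent, which kills the correction by [signed0]; degree
    less than [k0] makes the moments of [l0] and [l1] agree coordinate by coordinate. *)
Lemma block_law_moments (k0 : nat) (w : 'I_m -> nat) :
  (forall e, (e < k0)%N ->
     \sum_t l1 t * coord_ev K e t = \sum_t l0 t * coord_ev K e t) ->
  (block_wd w < minn m k0)%N ->
  \sum_x block_law true x * block_ev w x = \sum_x block_law false x * block_ev w x.
Proof.
move=> hk; rewrite leq_min => /andP[wm wk].
under [RHS]eq_bigr do rewrite mulrBl.
rewrite sumrB !tens_pair; have -> : \prod_i \sum_y signed0 y * coord_ev K (w i) y = 0.
  have /existsP[i /eqP wi] : [exists i, w i == 0%N].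
    apply: contraTT wm; rewrite negb_exists -leqNgt => /forallP h.
    rewrite -{1}(card_ord m) -sum1_card; apply: leq_sum => i _.
    by rewrite lt0n; apply: h.
  rewrite (bigD1 i) //= wi (eq_bigr signed0) ?signed0_sum ?mul0r // => t _.
  by rewrite /coord_ev expr0 mulr1.
rewrite subr0; apply: eq_bigr => i _; apply: hk; apply: leq_ltn_trans wk.
by rewrite /block_wd /tens_wd (bigD1 i) //= leq_addr.
Qed.

(** The point mass is first deformed into a product law [kap] dominated by [10 * b], and the result
    is then rebased to [b]. *)
Lemma block_deforms (z : K) (x : X) (b : X -> K) :
  0 <= z -> 8 * R%:R * z <= 1 ->
  (forall y, 0 <= b y) -> \sum_y b y = 1 ->
  (forall y, block_law (MP x) y <= 2 * b y) ->
  exists k, deforms block_wd block_ev z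
    (1 + 11 * z + 10 * ((1 + 257 * R%:R * z) ^+ m - 1)) x b k.
Proof.
move=> z0 Rz b0 b1 hb; set H1 := 1 + 257 * R%:R * z.
have R1 : 1 <= R%:R :> K by rewrite ler1n.
have zRz : z <= R%:R * z by rewrite ler_peMl.
have H11 : 1 <= H1.
  by rewrite lerDl; apply: mulr_ge0 z0; apply: mulr_ge0; apply: ler0n.
have H1m : 1 <= H1 ^+ m by rewrite exprn_ege1.
have ev1 : forall w, block_wd w = 0%N -> forall y, block_ev w y = 1.
  move=> w /eqP; rewrite /block_wd /tens_wd sum_nat_eq0 => /forallP h y.
  apply: big1 => i _; have /eqP -> := implyP (h i) isT.
  by rewrite /coord_ev expr0.
(* If [x] has a zero coordinate, one of them is frozen at 0: a product of [l0] alone would charge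
   points without zero coordinate, where [block_law false] vanishes. *)
pose j0 := [pick j | x j == ord0].
pose kap (j : 'I_m) : T -> K :=
  if MP x then l1 else if Some j == j0 then (fun t => (t == ord0)%:R) else l0.
have kap_ge0 j t : 0 <= kap j t.
  by rewrite /kap; case: ifP => // _; case: ifP.
have kap_sum j : \sum_t kap j t = 1.
  rewrite /kap; case: ifP => // _; case: ifP => // _.
  by rewrite (bigD1 ord0) //= big1 ?addr0 // => t /negPf ->.
have [k kP] : exists k, deforms block_wd block_ev z (H1 ^+ m) x (tens kap) k.
  rewrite -[m in H1 ^+ m]card_ord -prodr_const; apply: deforms_tens => // j.
  have [xj|xj] := posnP (x j); last first.
    rewrite /kap; case: ifP => _; first exact: coord_deforms_pos.
    case: ifP => [/eqP|_]; last exact: coord_deforms_pos.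
    rewrite /j0; case: pickP => // i /eqP xi [ij].
    by rewrite ij xi in xj.
  have xj0 : x j = ord0 by apply: val_inj.
  have hMP : MP x = false.
    by apply/negbTE; rewrite negb_forall; apply/existsP; exists j; rewrite xj.
  rewrite /kap hMP xj0; case: ifP => _.
    have [k kP] := @coord_deforms_delta K R z ord0.
    by exists k; apply: deforms_le kP.
  have l02 : 1 <= 2 * l0 ord0 by have := l0_0 => h; lra.
  have [k kP] := coord_deforms_dom z0 (ler0n K 2) l0_ge0 l0_sum l02.
  by exists k; apply: deforms_le kP => //; rewrite /H1; nra.
(* When a coordinate is frozen, $10=\frac53\cdot3\cdot2$: omitting its factor $l_0(0)$ costs $5/3$,
   [block_law_false_ge] costs 3, and the hypothesis on [b] costs 2. *)
have kb y : tens kap y <= 10 * b y.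
  have [h|h] := boolP (MP x).
    have := hb y; rewrite h /= /tens /kap h => h'; apply: le_trans h' _.
    by have := b0 y; lra.
  have [i xi j0E] : exists2 i, x i = ord0 & j0 = Some i.
    have [i0 xi0] := notMP h.
    rewrite /j0; case: pickP => [i /eqP xi|/(_ i0)]; first by exists i.
    by rewrite xi0 eqxx.
  have {}hb := hb y; rewrite (negbTE h) in hb.
  have [yi|yi] := eqVneq (y i) ord0; last first.
    rewrite /tens (bigD1 i) //= /kap (negbTE h) j0E eqxx (negbTE yi) mul0r.
    by rewrite mulr_ge0.
  have hy : ~~ MP y.
    by rewrite negb_forall; apply/existsP; exists i; rewrite yi.
  have t0 : tens (fun _ => l0) y = l0 ord0 * tens kap y.
    rewrite /tens (bigD1 i) //= [in RHS](bigD1 i) //= yi /kap (negbTE h) j0E.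
    rewrite !eqxx mul1r; congr (_ * _); apply: eq_bigr => j /negPf ji.
    by rewrite (inj_eq Some_inj) ji.
  have := block_law_false_ge hy; rewrite t0 => h1.
  have k0 : 0 <= tens kap y by apply: tens_ge0.
  have h2 : 3 / 5 * tens kap y <= l0 ord0 * tens kap y by rewrite ler_wpM2r.
  lra.
have [k' k'P] := deforms_rebase z0 (ler1n K 10) b0 kb
  (fun y => @tens_ge0 _ _ kap y kap_ge0) H1m (tens_total kap_sum) b1 ev1 kP.
by exists k'; apply: deforms_le k'P => //; lra.
Qed.

End Block.

Section Blocks.
Variables (K : realFieldType) (R m n : nat) (l0 l1 : 'I_R.+1 -> K).
Local Notation T := 'I_R.+1.
Local Notation X := {ffun 'I_m -> T}.
Local Notation MP x := [forall i, (1 <= x i)%N].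
Hypotheses (n_gt0 : (0 < n)%N) (m_gt0 : (0 < m)%N) (R_gt0 : (0 < R)%N).
Hypotheses (l0_ge0 : forall t, 0 <= l0 t) (l1_ge0 : forall t, 0 <= l1 t).
Hypotheses (l0_sum : \sum_t l0 t = 1) (l1_sum : \sum_t l1 t = 1).
Hypotheses (l1_0 : l1 ord0 = 0) (l0_0 : 3 / 5 <= l0 ord0).
Hypothesis l0_low : forall t : T, (0 < t)%N -> 8 ^- t / 2 <= l0 t.
Hypothesis l1_low : forall t : T, (0 < t)%N -> 8 ^- t / 2 <= l1 t.

Definition all_ev := @tens_ev K X _ (@block_ev K R m) 'I_n.
Definition all_wd := @tens_wd _ (@block_wd m) 'I_n.

(** The factor 2 in the hypothesis on [b] admits both the block law of the pattern of [x] and the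
    even mixture of the two block laws. *)
Lemma anticoncentration (x : {ffun 'I_n -> X}) (b : 'I_n -> X -> K) (d : nat)
    (J : finType) (c : J -> K) (w : J -> 'I_n -> 'I_m -> nat) p :
  (forall i y, 0 <= b i y) -> (forall i, \sum_y b i y = 1) ->
  (forall i y, block_law l0 l1 (MP (x i)) y <= 2 * b i y) ->
  (forall y, p y = \sum_j c j * all_ev (w j) y) ->
  (forall j, (all_wd (w j) <= d)%N) ->
  `|p x| <= 2 * (42 * 257 * (n * m * R)%:R) ^+ d * \sum_y tens b y * `|p y|.
Proof.
(* With $e=257mRz$, one block costs at most $1+e+20e$, and $(1+21e)^n\le1+42ne=2$ by the choice of
   $z$. *)
move=> b0 b1 hb pE wdd; pose z : K := (42 * 257 * (n * m * R)%:R)^-1.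
have n1 : 1 <= n%:R :> K by rewrite ler1n.
have m1 : 1 <= m%:R :> K by rewrite ler1n.
have R1 : 1 <= R%:R :> K by rewrite ler1n.
have q0 : 0 < 42 * 257 * (n * m * R)%:R :> K.
  by rewrite -!natrM ltr0n !muln_gt0 n_gt0 m_gt0.
have z0 : 0 < z by rewrite invr_gt0.
pose a := 257 * R%:R * z; pose e := m%:R * a.
have hz : 42 * (n%:R * e) = 1.
  have := mulfV (lt0r_neq0 q0); rewrite -/z !natrM => h; rewrite -[RHS]h /e /a.
  by ring.
have a0 : 0 <= a.
  by apply: mulr_ge0 (ltW z0); apply: mulr_ge0; apply: ler0n.
have za : 257 * z <= a.
  by rewrite /a -mulrA ler_wpM2l ?ler0n // ler_peMl // ltW.
have z16 : 16 * z <= a.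
  by apply: le_trans za; rewrite ler_wpM2r ?ler_nat // ltW.
have Ra : 8 * R%:R * z <= a.
  by rewrite /a -!mulrA ler_wpM2r ?mulr_ge0 ?ler_nat // ltW.
have ae : a <= e by rewrite ler_peMl.
clear za; have e0 : 0 <= e by apply: le_trans ae.
have he : e <= n%:R * e by rewrite ler_peMl.
have H1m : (1 + a) ^+ m <= 1 + 2 * e.
  by rewrite mulrA; apply: expr1D_le => //; rewrite -mulrA -/e; lra.
have zz : 0 < z <= 1 by rewrite z0 /=; lra.
have Hn : (1 + 11 * z + 10 * ((1 + a) ^+ m - 1)) ^+ n <= 2.
  apply: (@le_trans _ _ ((1 + 21 * e) ^+ n)).
    have H10 : 1 <= (1 + a) ^+ m by rewrite exprn_ege1 // lerDl.
    by rewrite lerXn2r ?nnegrE; lra.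
  by apply: le_trans (expr1D_le _ _) _; lra.
have [k kP] : exists k, deforms all_wd all_ev z
    ((1 + 11 * z + 10 * ((1 + a) ^+ m - 1)) ^+ n) x (tens b) k.
  rewrite -[n in _ ^+ n]card_ord -prodr_const; apply: deforms_tens; first exact: ltW.
  move=> i; apply: (@block_deforms K R m l0 l1) => //; first exact: ltW.
  by lra.
have := deforms_bound zz pE wdd kP; move/le_trans; apply.
rewrite ler_wpM2r ?sumr_ge0 // => [y _|]; first by rewrite mulr_ge0 ?tens_ge0.
rewrite -exprVn /z invrK [leRHS]mulrC; apply: ler_wpM2l Hn.
by apply: exprn_ge0; apply: ltW.
Qed.

End Blocks.

(** * The univariate dual object *)

(** The sum is the coefficient of $X^{n-1}$ in the Lagrange interpolation of $p$ at $n$ nodes, which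
    is $p$ itself. *)
Lemma divided_difference_eq0 (K : fieldType) (n : nat) (x : nat -> K)
    (p : {poly K}) : injective x -> (size p < n)%N ->
  \sum_(i < n) p.[x i] / \prod_(j < n | j != i) (x i - x j) = 0.
Proof.
move=> xI sp; have n0 : (0 < n)%N by apply: leq_trans sp.
have := congr1 (fun q : {poly K} => q`_n.-1) (lagrange_gen n0 xI (ltnW sp)).
rewrite nth_default; last by rewrite -ltnS prednK.
rewrite coef_sum => e; rewrite [RHS]e.
apply: eq_bigr => i _; rewrite (lagrangeE n0 xI) /= mulrA -polyCM coefCM.
have -> : (\prod_(j < n | j != i) ('X - (x j)%:P)).[x i] =
    \prod_(j < n | j != i) (x i - x j).
  by rewrite horner_prod; apply: eq_bigr => j _; rewrite !hornerE.
set q := \prod_(j < n | j != i) ('X - (x j)%:P).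
have qm : q \is monic by apply: monic_prod => j _; apply: monicXsubC.
have sq : size q = n.
  rewrite size_prod => [|j _]; last by rewrite polyXsubC_eq0.
  rewrite (eq_bigr (fun => 2%N)) => [|j _]; last by rewrite size_XsubC.
  rewrite sum_nat_const (_ : #|_| = n.-1); first by lia.
  by rewrite (cardC1 i) card_ord.
by have := monicP qm; rewrite /lead_coef sq => ->; rewrite mulr1.
Qed.

(** Squares turn the products of differences into factorials. The extra nodes 1 and 4 give the
    weight at $64a^2$ a decay of order $a^{-4}$, summable even against a factor $a^2$. *)
Definition node (j : nat) : nat :=
  match j with 0 => 0 | 1 => 1 | 2 => 4 | j'.+3 => 64 * j'.+1 ^ 2 end%N.

Lemma node_inj : injective node.
Proof.
move=> [|[|[|i]]] [|[|[|j]]] //=; rewrite ?expnS ?expn0; try lia.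
by move=> h; congr _.+3; nia.
Qed.

Definition nodeR (K : realFieldType) (j : nat) : K := (node j)%:R.

Section NodeWeights.
Variables (K : realFieldType) (k : nat).
Local Notation v := (@nodeR K).

(** The coefficients of the divided difference, normalized to be 1 at the node 0. *)
Definition weight (j : 'I_k.+3) : K :=
  (\prod_(i < k.+3 | i != ord0) (v 0%N - v i)) /
  \prod_(i < k.+3 | i != j) (v j - v i).

Lemma node_injR : injective v.
Proof. by move=> i j /eqP; rewrite eqr_nat => /eqP /node_inj. Qed.

Lemma nodeB_neq0 (j : 'I_k.+3) : \prod_(i < k.+3 | i != j) (v j - v i) != 0.
Proof.
apply/prodf_neq0 => i ij; rewrite subr_eq0; apply: contraNneq ij.
by move/node_injR/val_inj => ->.
Qed.

Lemma weight0 : weight ord0 = 1.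
Proof. by rewrite /weight mulfV // nodeB_neq0. Qed.

Lemma weight_moments (e : nat) : (e < k.+2)%N ->
  \sum_j weight j * v j ^+ e = 0.
Proof.
move=> ek; have sX : (size ('X^e : {poly K}) < k.+3)%N by rewrite size_polyXn.
have := divided_difference_eq0 node_injR sX.
move/(congr1 ( *%R (\prod_(i < k.+3 | i != ord0) (v 0%N - v i)))).
rewrite mulr0 mulr_sumr => {2}<-; apply: eq_bigr => j _.
by rewrite /weight hornerXn mulrAC mulrA.
Qed.

Lemma prod_addn_fact (a c : nat) :
  (\prod_(b < c) (a + b.+1) * a`! = (a + c)`!)%N.
Proof.
elim: c => [|c IH]; first by rewrite big_ord0 mul1n addn0.
by rewrite big_ord_recr /= mulnAC IH addnS factS mulnC.
Qed.

Lemma prod_subn_fact (a c : nat) : (c <= a)%N ->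
  (\prod_(b < c) (a.+1 - b.+1) * (a - c)`! = a`!)%N.
Proof.
elim: c => [|c IH] ca; first by rewrite big_ord0 mul1n subn0.
rewrite big_ord_recr /= -IH ?(ltnW ca) // -mulnA subSS; congr (_ * _)%N.
by rewrite -(subnSK ca) factS.
Qed.

(** Induction on [k]: the new factor splits as $c^2-a^2=(c-a)(c+a)$, and each half extends one
    factorial. *)
Lemma prod_sqrB (a : nat) : (a < k)%N ->
  2 * k`!%:R ^+ 2 * \prod_(b < k | (b : nat) != a) `|a.+1%:R ^+ 2 - b.+1%:R ^+ 2| =
  (k - a.+1)`!%:R * (k + a.+1)`!%:R * \prod_(b < k | (b : nat) != a) b.+1%:R ^+ 2 :> K.
Proof.
elim: k => [//|c IH]; rewrite ltnS leq_eqVlt => /predU1P[->{IH}|ac]; last first.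
  rewrite big_mkcond [in RHS]big_mkcond /= !big_ord_recr /= (gtn_eqF ac) /=.
  rewrite -!big_mkcond /=.
  set P1 := \prod_(i < c | _) _; set P2 := \prod_(i < c | _) _.
  have {}IH : 2 * c`!%:R ^+ 2 * P1 = (c - a.+1)`!%:R * (c + a.+1)`!%:R * P2.
    exact: IH.
  have -> : `|a.+1%:R ^+ 2 - c.+1%:R ^+ 2| = (c - a)%:R * (c.+1 + a.+1)%:R :> K.
    rewrite distrC subr_sqr ger0_norm; last first.
      apply: mulr_ge0; last exact: addr_ge0.
      by rewrite subr_ge0 ler_nat ltnS ltnW.
    by rewrite natrD (natrB _ (ltnW ac)) -!natr1; ring.
  have -> : (c.+1 - a.+1)`! = ((c - a) * (c - a.+1)`!)%N.
    by rewrite subSS -(subnSK ac) factS.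
  have -> : (c.+1 + a.+1)`! = ((c.+1 + a.+1) * (c + a.+1)`!)%N.
    by rewrite addSn factS.
  rewrite factS !natrM.
  transitivity (c.+1%:R ^+ 2 * (c - a)%:R * (c.+1 + a.+1)%:R *
     (2 * c`!%:R ^+ 2 * P1)); first by ring.
  by rewrite IH; ring.
rewrite big_mkcond [in RHS]big_mkcond /= !big_ord_recr /= eqxx /= !mulr1.
rewrite -!big_mkcond /= subnn fact0.
have pT (F : 'I_c -> K) : \prod_(b < c | (b : nat) != c) F b = \prod_(b < c) F b.
  by apply: eq_bigl => b; rewrite ltn_eqF.
rewrite !pT {pT}.
rewrite (eq_bigr (fun b : 'I_c => (c.+1 - b.+1)%:R * (c.+1 + b.+1)%:R)); last first.
  move=> b _; have bc : (b.+1 <= c.+1)%N by rewrite ltnS ltnW.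
  rewrite subr_sqr ger0_norm ?(natrD, natrB _ bc) //.
  by apply: mulr_ge0; [rewrite subr_ge0 ler_nat | apply: addr_ge0].
rewrite big_split /= -!natr_prod prodrXl -natr_prod.
have p1 : (\prod_(b < c) (c.+1 - b.+1) = c`!)%N.
  by rewrite -(prod_subn_fact (leqnn c)) subnn fact0 muln1.
have p2 : (\prod_(b < c) b.+1 = c`!)%N.
  by rewrite -[c in RHS]add0n -prod_addn_fact fact0 muln1; apply: eq_bigr.
have := prod_addn_fact c.+1 c => /(congr1 (fun i => i%:R : K)); rewrite natrM => h2.
rewrite p1 p2.
have -> : (c.+1 + c.+1)`! = ((c.+1 + c.+1) * (c.+1 + c)`!)%N by rewrite addnS factS.
rewrite natrM -h2 factS natrM natrD. ring.
Qed.

Lemma prod_nodes (t : K) (x : nat) : \prod_(i < k.+3 | (i : nat) != x) `|t - v i| =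
  (if 0%N != x then `|t - 0| else 1) * ((if 1%N != x then `|t - 1| else 1) *
  ((if 2%N != x then `|t - 4| else 1) *
   \prod_(b < k | b.+3 != x) `|t - 64 * b.+1%:R ^+ 2|)).
Proof.
rewrite big_mkcond !big_ord_recl /= -big_mkcond /=; do 3! congr (_ * _).
by apply: eq_bigr => b _; rewrite /nodeR /= natrM natrX.
Qed.

(** The powers of 64 cancel, and [prod_sqrB] evaluates the rest; the constant 8 is the node 4 times
    the 2 of that identity. *)
Lemma norm_weight3 (j : 'I_k.+3) (a : nat) : (j : nat) = a.+3 ->
  `|weight j| = 8 / ((v j - 1) * (v j - 4)) *
    (k`!%:R ^+ 2 / ((k - a.+1)`!%:R * (k + a.+1)`!%:R)).
Proof.
move=> ja; have ak : (a < k)%N by have := ltn_ord j; rewrite ja !ltnS.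
rewrite /weight normrM normfV !normr_prod.
rewrite (eq_bigl (fun i : 'I_k.+3 => (i : nat) != 0%N)) // (prod_nodes (v 0%N)) /=.
rewrite (eq_bigl (fun i : 'I_k.+3 => (i : nat) != a.+3)); last first.
  by move=> i; rewrite -(inj_eq val_inj) /= ja.
rewrite (prod_nodes (v j)) /= ja /nodeR /= mul1r !sub0r !normrN normr1 mul1r subr0.
set t : K := (64 * a.+1 ^ 2)%:R.
have tE : t = 64 * a.+1%:R ^+ 2 by rewrite /t natrM natrX.
have a1 : 1 <= a.+1%:R ^+ 2 :> K by rewrite exprn_ege1 // ler1n.
have t64 : 64 <= t by rewrite tE ler_peMr.
rewrite (bigD1 (Ordinal ak)) //= sub0r normrN -tE.
rewrite !(@ger0_norm _ t) ?(@ger0_norm _ (t - 1)) ?(@ger0_norm _ (t - 4));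
  try by lra.
rewrite (@ger0_norm _ 4) //.
have -> : \prod_(i < k | i != Ordinal ak) `|0 - 64 * i.+1%:R ^+ 2| =
    \prod_(b < k | (b : nat) != a) (64 : K) * \prod_(b < k | (b : nat) != a) b.+1%:R ^+ 2.
  rewrite -big_split /=; apply: eq_big => [b|b _].
    by rewrite -(inj_eq val_inj).
  by rewrite sub0r normrN ger0_norm // mulr_ge0 ?exprn_ge0.
have -> : \prod_(b < k | b.+3 != a.+3) `|t - 64 * b.+1%:R ^+ 2| =
    \prod_(b < k | (b : nat) != a) (64 : K) *
    \prod_(b < k | (b : nat) != a) `|a.+1%:R ^+ 2 - b.+1%:R ^+ 2|.
  rewrite -big_split /=; apply: eq_big => [b|b _]; first by rewrite !eqSS.
  by rewrite tE -mulrBr normrM (@ger0_norm _ 64).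
have := prod_sqrB ak.
set P1 := \prod_(b < k | _) _; set P2 := \prod_(b < k | _) _ => h.
set P64 := \prod_(b < k | _) _.
have P640 : P64 != 0 by apply/prodf_neq0 => b _; rewrite pnatr_eq0.
have f0 i : i`!%:R != 0 :> K by rewrite pnatr_eq0 -lt0n fact_gt0.
have P20 : P2 != 0.
  by apply/prodf_neq0 => b _; rewrite expf_neq0 // pnatr_eq0.
have P10 : P1 != 0.
  apply/prodf_neq0 => b ba; rewrite normr_eq0 subr_eq0 eqrXn2 //.
  by rewrite eqr_nat eqSS eq_sym.
have -> : P2 = 2 * k`!%:R ^+ 2 * P1 / ((k - a.+1)`!%:R * (k + a.+1)`!%:R).
  by rewrite h mulrC mulKf // mulf_neq0.
have [t0 t1 t4] : [/\ t != 0, t - 1 != 0 & t - 4 != 0].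
  by split; rewrite gt_eqF //; lra.
clearbody t P1 P2 P64.
by field; rewrite ?f0 ?P640 ?P10 ?t0 ?t1 ?t4.
Qed.

Lemma prod_64sqr_le :
  \prod_(b < k) (64 * b.+1%:R ^+ 2) <=
  8 / 7 * \prod_(b < k) (64 * b.+1%:R ^+ 2 - 4) :> K.
Proof.
have sq1 (b : nat) : 1 <= b.+1%:R ^+ 2 :> K by rewrite exprn_ege1 // ler1n.
have p0 c : 0 <= \prod_(b < c) (64 * b.+1%:R ^+ 2) :> K.
  by apply: prodr_ge0 => b _; rewrite mulr_ge0 ?exprn_ge0.
(* The bound is strengthened so that it is an equality for $k=0$ and passes through the
   induction. *)
have : (7 / 8 + 1 / (8 * k.+1%:R)) * \prod_(b < k) (64 * b.+1%:R ^+ 2) <=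
    \prod_(b < k) (64 * b.+1%:R ^+ 2 - 4) :> K.
  elim: k => [|c IH]; first by rewrite !big_ord0 mulr1; lra.
  rewrite !big_ord_recr /=; set P := \prod_(b < c) _ in IH *.
  have P0 : 0 <= P := p0 c.
  set s := c.+1%:R in IH *.
  have s1 : 1 <= s by rewrite ler1n.
  have ss : c.+2%:R = s + 1 :> K by rewrite natr1.
  rewrite ss; have hs : 0 <= 64 * s ^+ 2 - 4 by have := sq1 c; rewrite -/s; lra.
  apply: le_trans (ler_wpM2r hs IH); rewrite [leLHS]mulrCA.
  rewrite [leRHS]mulrAC [leRHS]mulrC; apply: ler_wpM2l => //.
  rewrite -subr_ge0.
  have -> : (7 / 8 + 1 / (8 * s)) * (64 * s ^+ 2 - 4) -
     (7 / 8 + 1 / (8 * (s + 1))) * (64 * s ^+ 2) =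
     (8 * s / (s + 1) - 7 / 2 - 1 / (2 * s)).
    by field; rewrite gt_eqF ?gt_eqF //; lra.
  have -> : 8 * s / (s + 1) - 7 / 2 - 1 / (2 * s) =
     (9 * s ^+ 2 - 8 * s - 1) / (2 * s * (s + 1)).
    by field; rewrite gt_eqF ?gt_eqF //; lra.
  by rewrite divr_ge0 //; nra.
set P := \prod_(b < k) (64 * _ ^+ 2); set Q := \prod_(b < k) _ => h.
have P0 : 0 <= P := p0 k.
have : 0 <= 1 / (8 * k.+1%:R) * P by rewrite mulr_ge0 // divr_ge0 // mulr_ge0.
by move: h; rewrite mulrDl; move: (1 / (8 * k.+1%:R) * P) => u h u0; lra.
Qed.

(** The nodes 0, 1 and 4 contribute $4/(4\cdot3)$, and the others at most $8/7$ by
    [prod_64sqr_le]. *)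
Lemma norm_weight2 (j : 'I_k.+3) : (j : nat) = 2 -> `|weight j| <= 8 / 21.
Proof.
move=> j2; rewrite /weight normrM normfV !normr_prod.
rewrite (eq_bigl (fun i : 'I_k.+3 => (i : nat) != 0%N)) // (prod_nodes (v 0%N)) /=.
rewrite (eq_bigl (fun i : 'I_k.+3 => (i : nat) != 2)); last first.
  by move=> i; rewrite -(inj_eq val_inj) /= j2.
rewrite (prod_nodes (v j)) /= j2 /nodeR /= mul1r !sub0r !normrN normr1 !mul1r subr0.
have sq1 (b : nat) : 1 <= b.+1%:R ^+ 2 :> K by rewrite exprn_ege1 // ler1n.
rewrite (eq_bigr (fun b : 'I_k => 64 * b.+1%:R ^+ 2)) => [|b _]; last first.
  by rewrite sub0r normrN ger0_norm // mulr_ge0 ?exprn_ge0.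
rewrite [X in _ / (_ * (_ * X))](eq_bigr (fun b : 'I_k => 64 * b.+1%:R ^+ 2 - 4)).
  rewrite (@ger0_norm _ 4) // (@ger0_norm _ (4 - 1)); last by lra.
  have := prod_64sqr_le; set P := \prod_(b < k) _; set Q := \prod_(b < k) _ => h.
  have Q0 : 0 < Q by apply: prodr_gt0 => b _; have := sq1 b; lra.
  by rewrite ler_pdivrMr; last (by rewrite !mulr_gt0 //; lra); lra.
by move=> b _; rewrite distrC ger0_norm //; have := sq1 b; lra.
Qed.

Lemma sum_inv_sqr_le (c : nat) : \sum_(b < c) (b.+1%:R ^+ 2)^-1 <= 2 :> K.
Proof.
case: c => [|c]; first by rewrite big_ord0.
(* A telescoping bound. *)
have : \sum_(b < c.+1) (b.+1%:R ^+ 2)^-1 <= 2 - c.+1%:R^-1 :> K.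
  elim: c => [|c IH]; first by rewrite big_ord1 expr1n invr1; lra.
  rewrite big_ord_recr /=; apply: le_trans (lerD IH (lexx _)) _.
  set s := c.+1%:R; have s1 : 1 <= s by rewrite ler1n.
  have -> : c.+2%:R = s + 1 by rewrite natr1.
  rewrite -subr_ge0; have -> : 2 - (s + 1)^-1 - (2 - s^-1 + ((s + 1) ^+ 2)^-1) =
    1 / (s * (s + 1) ^+ 2).
    by field; rewrite gt_eqF ?gt_eqF //; lra.
  by rewrite divr_ge0 // mulr_ge0 ?exprn_ge0 //; lra.
by move/le_trans; apply; rewrite lerBlDr lerDl invr_ge0.
Qed.

End NodeWeights.

(** * Exponential estimates *)

Section Exponential.
Variable K : realType.

Lemma expR_ge1 (x : K) : 0 <= x -> 1 <= expR x.
Proof. by move=> x0; apply: le_trans (expR_ge1Dx x); rewrite lerDl. Qed.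

Lemma expR_1B_le (x : K) : expR x * (1 - x) <= 1.
Proof.
have := expR_ge1Dx (- x); rewrite expRN => h.
by rewrite -ler_pdivlMl ?expR_gt0 // mulr1.
Qed.

Lemma expR_sub1_le (x : K) : 0 <= x <= 1 / 2 -> expR x - 1 <= 2 * x.
Proof.
move=> /andP[x0 x1]; have := expR_1B_le x; have : 1 <= expR x by rewrite expR_ge1.
by move: (expR x) => E E1 h; nra.
Qed.

(** Gaussian decay of binomial coefficients away from the centre. Passing from $a$ to $a+1$ brings
    the ratio $(k-a)/(k+a+1)=1-y$ with $y\ge c(2a+1)$, and $e^y(1-y)\le1$. *)
Lemma fact_sqr_expR_le (k a : nat) (c : K) : (a <= k)%N -> 0 <= c ->
  c * (2 * k%:R) <= 1 ->
  k`!%:R ^+ 2 * expR (c * a%:R ^+ 2) <= (k - a)`!%:R * (k + a)`!%:R.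
Proof.
move=> ak c0 ck; elim: a ak => [|a IH] ak.
  by rewrite expr0n mulr0 expR0 mulr1 subn0 addn0 expr2.
have k0 : 0 < k%:R - a%:R :> K by rewrite subr_gt0 ltr_nat.
have k2 : 0 < k%:R + a%:R + 1 :> K by rewrite ltr_wpDl.
have step : (k%:R - a%:R) * expR (c * (2 * a%:R + 1)) <= k%:R + a%:R + 1 :> K.
  set y := (2 * a%:R + 1) / (k%:R + a%:R + 1) : K.
  have cy : c * (2 * a%:R + 1) <= y.
    rewrite /y ler_pdivlMr // mulrAC -[leRHS]mul1r ler_wpM2r //.
    apply: le_trans ck; rewrite ler_wpM2l // -!natrD natr1 -natrM ler_nat; lia.
  apply: (@le_trans _ _ ((k%:R - a%:R) * expR y)).
    by rewrite ler_wpM2l ?ler_expR // ltW.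
  have e1 : 1 - y = (k%:R - a%:R) / (k%:R + a%:R + 1).
    by rewrite /y; field; rewrite gt_eqF.
  have := expR_1B_le y; rewrite e1 mulrA ler_pdivrMr // mul1r.
  by rewrite mulrC.
have {}IH := IH (ltnW ak).
have eS : expR (c * a.+1%:R ^+ 2) =
    expR (c * a%:R ^+ 2) * expR (c * (2 * a%:R + 1)) :> K.
  by rewrite -expRD; congr expR; rewrite -natr1; ring.
rewrite eS mulrA.
have fa : (k - a)`!%:R = (k%:R - a%:R) * (k - a.+1)`!%:R :> K.
  by rewrite -(subnSK ak) factS natrM subnSK // natrB // ltnW.
have fb : (k + a.+1)`!%:R = (k%:R + a%:R + 1) * (k + a)`!%:R :> K.
  by rewrite addnS factS natrM -natr1 natrD.
rewrite fa in IH; rewrite fb.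
set E := expR (c * (2 * a%:R + 1)) in step *.
have E0 : 0 <= E by apply: expR_ge0.
apply: le_trans (ler_wpM2r E0 IH) _.
have F0 : 0 <= (k - a.+1)`!%:R * (k + a)`!%:R :> K by rewrite mulr_ge0.
by have := ler_wpM2r F0 step; rewrite [X in X <= _ -> _]mulrAC; nra.
Qed.

End Exponential.

(** * The divided difference as a signed weight on $\{0,\dots,R\}$ *)

Section DualWeight.
Variables (K : realType) (R : nat).
Local Notation T := 'I_R.+1.

(** The weights are pushed forward along the nodes, all at most $64k^2\le R$. The factorial ratio
    [E] in the weight at $64a^2$ absorbs $e^{64sa^2}$, which is where $128sk\le1$ is used. *)
Lemma dual_weight (k : nat) (s : K) : (0 < k)%N -> (64 * k ^ 2 <= R)%N ->
  0 <= s -> 64 * s * (2 * k%:R) <= 1 ->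
  exists w : T -> K,
    [/\ w ord0 = 1, \sum_(t : T | (1 < t)%N) `|w t| <= 1 / 2,
        forall e, (e < k.+2)%N -> \sum_t w t * coord_ev K e t = 0
      & \sum_t `|w t| * (expR (s * (t : nat)%:R) - 1) <= 8 * s].
Proof.
move=> k0 kR s0 sk.
have k1 : 1 <= k%:R :> K by rewrite ler1n.
have nodeR_lt (j : 'I_k.+3) : (node j < R.+1)%N.
  rewrite ltnS; case: j => [[|[|[|j]]] hj] //=; apply: leq_trans kR; nia.
pose nd (j : 'I_k.+3) : T := Ordinal (nodeR_lt j).
pose w (t : T) : K := \sum_j (nd j == t)%:R * weight K j.
have wsum (g : T -> K) : \sum_t w t * g t = \sum_j weight K j * g (nd j).
  under eq_bigr do rewrite mulr_suml; rewrite exchange_big /=.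
  apply: eq_bigr => j _; rewrite (bigD1 (nd j)) //= eqxx mul1r big1 ?addr0 //.
  by move=> t /negPf; rewrite eq_sym => ->; rewrite !mul0r.
have wnorm (g : T -> K) : (forall t, 0 <= g t) ->
    \sum_t `|w t| * g t <= \sum_j `|weight K j| * g (nd j).
  move=> g0; apply: (@le_trans _ _
    (\sum_t (\sum_j (nd j == t)%:R * `|weight K j|) * g t)).
    apply: ler_sum => t _; rewrite ler_wpM2r //.
    apply: le_trans (ler_norm_sum _ _ _) _; apply: ler_sum => j _.
    by rewrite normrM normr_nat.
  under eq_bigr do rewrite mulr_suml; rewrite exchange_big /=.
  apply: ler_sum => j _; rewrite (bigD1 (nd j)) //= eqxx mul1r big1 ?addr0 //.
  by move=> t /negPf; rewrite eq_sym => ->; rewrite !mul0r.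
pose o1 : 'I_k.+3 := lift ord0 ord0.
pose o2 : 'I_k.+3 := lift ord0 (lift ord0 ord0).
pose o3 (a : 'I_k) : 'I_k.+3 := lift ord0 (lift ord0 (lift ord0 a)).
have split3 (F : 'I_k.+3 -> K) :
    \sum_j F j = F ord0 + (F o1 + (F o2 + \sum_(a < k) F (o3 a))).
  by rewrite !big_ord_recl.
pose E (a : nat) : K := k`!%:R ^+ 2 / ((k - a.+1)`!%:R * (k + a.+1)`!%:R).
have sq1 (a : nat) : 1 <= a.+1%:R ^+ 2 :> K by rewrite exprn_ege1 // ler1n.
have w3 a : `|weight K (o3 a)| = 8 / ((64 * a.+1%:R ^+ 2 - 1) *
    (64 * a.+1%:R ^+ 2 - 4)) * E a.
  by rewrite (@norm_weight3 _ _ _ a) // /nodeR /= natrM natrX.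
have f0 i : 0 < i`!%:R :> K by rewrite ltr0n fact_gt0.
have Eexp (a : 'I_k) : E a * expR (s * (64 * a.+1%:R ^+ 2)) <= 1.
  rewrite /E mulrAC ler_pdivrMr ?mulr_gt0 // mul1r.
  have -> : s * (64 * a.+1%:R ^+ 2) = 64 * s * a.+1%:R ^+ 2 by ring.
  by apply: fact_sqr_expR_le; rewrite ?mulr_ge0.
have E0 (a : nat) : 0 <= E a by rewrite divr_ge0 ?exprn_ge0 ?mulr_ge0 // ltW.
have w2 : `|weight K o2| <= 8 / 21 by apply: norm_weight2.
have st0 (a : nat) : 0 <= s * (64 * a.+1%:R ^+ 2).
  by rewrite mulr_ge0 // mulr_ge0 // exprn_ge0.
have w3_le (a : 'I_k) : `|weight K (o3 a)| <= 400^-1 * (a.+1%:R ^+ 2)^-1.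
  have Ea : E a <= 1.
    by apply: le_trans (Eexp a); rewrite ler_peMr // expR_ge1.
  rewrite w3; set q := a.+1%:R ^+ 2; have q1 : 1 <= q := sq1 a.
  apply: (@le_trans _ _ (8 / ((64 * q - 1) * (64 * q - 4)))).
    rewrite ler_piMr // divr_ge0 // mulr_ge0; lra.
  rewrite -invfM ler_pdivrMr; last by rewrite mulr_gt0; lra.
  rewrite mulrC ler_pdivlMr; last by lra.
  by nra.
(* With $x=64sa^2$ for the 1-based index $a$, $e^x-1\le xe^x$ and [E] absorbs $e^x$; the factor $x$
   still leaves summable terms of order $s/a^2$. *)
have w3_exp (a : 'I_k) : `|weight K (o3 a)| *
    (expR (s * (64 * a.+1%:R ^+ 2)) - 1) <= s / 2 * (a.+1%:R ^+ 2)^-1.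
  rewrite w3; set q := a.+1%:R ^+ 2; have q1 : 1 <= q := sq1 a.
  have Ex := Eexp a; rewrite -/q in Ex.
  have h1 := expR_1B_le (s * (64 * q)).
  have h2 : E a * (expR (s * (64 * q)) - 1) <= s * (64 * q).
    have h3 : expR (s * (64 * q)) - 1 <= s * (64 * q) * expR (s * (64 * q)).
      by lra.
    apply: le_trans (ler_wpM2l (E0 a) h3) _.
    rewrite mulrCA -[leRHS]mulr1 ler_wpM2l //; exact: st0.
  set c := 8 / _; rewrite -[leLHS]mulrA.
  have c0 : 0 <= c by rewrite divr_ge0 // mulr_ge0; lra.
  apply: le_trans (ler_wpM2l c0 h2) _.
  have hc : c * (64 * q) <= 1 / 2 / q.
    rewrite ler_pdivlMr; last by lra.
    rewrite /c mulrAC -mulrA mulrAC ler_pdivrMr; last by rewrite mulr_gt0; lra.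
    by nra.
  by rewrite mulrCA; apply: le_trans (ler_wpM2l s0 hc) _; rewrite !mulrA mulr1.
have s_le : 64 * s <= 1 / 2 by nra.
have sum2 : \sum_(a < k) (a.+1%:R ^+ 2)^-1 <= 2 :> K := sum_inv_sqr_le K k.
have W3 : \sum_(a < k) `|weight K (o3 a)| <= 1 / 100.
  apply: le_trans (ler_sum _ (fun a _ => w3_le a)) _.
  by rewrite -mulr_sumr; lra.
(* The weight at the node 1 is determined by the others, since the total mass vanishes. *)
have W1 : `|weight K o1| <= 3 / 2.
  have := weight_moments K (isT : (0 < k.+2)%N); rewrite split3 weight0.
  rewrite !expr0 !mulr1 (eq_bigr (fun a => weight K (o3 a))); last first.
    by move=> a _; rewrite expr0 mulr1.
  move=> h; have -> : weight K o1 =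
     - (1 + (weight K o2 + \sum_(a < k) weight K (o3 a))) by lra.
  rewrite normrN; apply: le_trans (ler_normD _ _) _; rewrite normr1.
  have h1 := ler_normD (weight K o2) (\sum_(a < k) weight K (o3 a)).
  have h2 : `|\sum_(a < k) weight K (o3 a)| <= \sum_(a < k) `|weight K (o3 a)|.
    exact: ler_norm_sum.
  by lra.
exists w; split.
- rewrite /w (bigD1 ord0) //= big1 ?addr0 ?weight0 ?mulr1 ?eqxx //.
  move=> j j0; case: eqP => [/(congr1 val) /= e|_]; last by rewrite mul0r.
  by case/eqP: j0; apply: val_inj; apply: node_inj; rewrite e.
- rewrite big_mkcond /=.
  rewrite (eq_bigr (fun t : T => `|w t| * (1 < t)%N%:R)); last first.
    by move=> t _; case: ifP; rewrite ?mulr1 ?mulr0.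
  apply: le_trans (wnorm _ _) _ => //; rewrite split3 /= !mulr0 !add0r mulr1.
  rewrite (eq_bigr (fun a => `|weight K (o3 a)|)) => [|a _]; first by lra.
  by rewrite /= (_ : (1 < _)%N) ?mulr1 // (@leq_trans 64) // leq_pmulr // expn_gt0.
- move=> e ek; rewrite wsum -[RHS](weight_moments K ek).
  by apply: eq_bigr => j _.
apply: le_trans (wnorm _ _) _ => [t|].
  by rewrite subr_ge0 expR_ge1 // mulr_ge0.
rewrite split3 /= mulr0 expR0 subrr mulr0 add0r mulr1.
have e1 : expR s - 1 <= 2 * s by apply: expR_sub1_le; rewrite s0; lra.
have e4 : expR (s * 4) - 1 <= 2 * (s * 4) by apply: expR_sub1_le; lra.
have e10 : 0 <= expR s - 1 by rewrite subr_ge0 expR_ge1.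
have e40 : 0 <= expR (s * 4) - 1 by rewrite subr_ge0 expR_ge1 // mulr_ge0.
(* The nodes 1 and 4 and the remaining ones contribute at most $3s$, $64s/21$ and $s$. *)
have S1 := ler_pM (normr_ge0 _) e10 W1 e1.
have S2 := ler_pM (normr_ge0 _) e40 w2 e4.
have S3 : \sum_(a < k) `|weight K (o3 a)| *
    (expR (s * (node (o3 a))%:R) - 1) <= s.
  apply: (@le_trans _ _ (\sum_(a < k) s / 2 * (a.+1%:R ^+ 2)^-1)).
    by apply: ler_sum => a _; rewrite /= natrM natrX.
  by rewrite -mulr_sumr; nra.
by lra.
Qed.

End DualWeight.

(** * The two laws on one coordinate *)

Section Laws.
Variables (K : realType) (R : nat).
Local Notation T := 'I_R.+1.

Record is_dual (k0 : nat) (s : K) (w : T -> K) : Prop := IsDual {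
  dual_at0 : w ord0 = 1;
  dual_mass : \sum_(t : T | (1 < t)%N) `|w t| <= 1 / 2;
  dual_moments : forall e, (e < k0)%N -> \sum_t w t * coord_ev K e t = 0;
  dual_exp : \sum_t `|w t| * (expR (s * (t : nat)%:R) - 1) <= 8 * s }.

Lemma exists_dual (r : nat) : (0 < r)%N -> (r <= R)%N ->
  exists k0 w, [/\ (0 < k0)%N, Num.sqrt r%:R <= 8 * k0%:R :> K
    & is_dual k0 (16 * Num.sqrt r%:R)^-1 w].
Proof.
move=> r0 rR; set s := (16 * Num.sqrt r%:R)^-1.
have q1 : 1 <= Num.sqrt r%:R :> K by rewrite -[leLHS]sqrtr1 ler_sqrt ?ler1n.
have s0 : 0 <= s by rewrite invr_ge0 mulr_ge0.
have s16 : s <= 1 / 16.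
  by rewrite /s invfM div1r ler_piMr ?invr_ge0 // invf_le1 // (lt_le_trans ltr01).
have exk : exists k, (r < 64 * k.+1 ^ 2)%N.
  by exists r; rewrite expnS expn1; nia.
case: (ex_minnP exk) => k rk mink.
have qk : Num.sqrt r%:R <= 8 * k.+1%:R :> K.
  rewrite -(@ger0_norm _ (8 * k.+1%:R)) ?mulr_ge0 // -sqrtr_sqr.
  rewrite ler_sqrt ?exprn_ge0 ?mulr_ge0 //.
  by rewrite exprMn -natrX -natrX -natrM ler_nat ltnW.
(* For $r<64$ the signed measure $\delta_0-\delta_1$ is enough, as $\sqrt r\le8$; otherwise
   minimality gives $64k^2\le r$ with $k\ge1$. *)
case: k => [|k] in rk mink qk *.
  exists 1%N, (fun t : T => (t == ord0)%:R - ((t : nat) == 1%N)%:R); split=> //.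
  have R1 : (1 < R.+1)%N by rewrite ltnS; apply: leq_trans rR.
  have ne (t : T) : (1 < t)%N ->
      (t == ord0)%:R - ((t : nat) == 1%N)%:R = 0 :> K.
    by case: t => [[|[|t]] ht] //= _; rewrite subr0.
  have gt1 (t : T) : t != ord0 -> t != Ordinal R1 -> (1 < t)%N.
    by case: t => [[|[|t]] ht].
  split.
  - by rewrite eqxx subr0.
  - by rewrite big1 => [|t t1]; [lra | rewrite ne ?normr0].
  - move=> [|//] _; under eq_bigr do rewrite /coord_ev expr0 mulr1.
    rewrite (bigD1 ord0) //= (bigD1 (Ordinal R1)) //= big1 => [|t].
      by rewrite ?eqxx /= subr0 sub0r addr0 subrr.
    by move=> /andP[ta tb]; rewrite ne ?gt1.
  rewrite (bigD1 ord0) //= (bigD1 (Ordinal R1)) //= big1 => [|t].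
    rewrite mulr0 expR0 subrr mulr0 add0r addr0 sub0r normrN normr1 mul1r mulr1.
    by have := @expR_sub1_le K s; rewrite s0 /= => /(_ _) h; lra.
  by move=> /andP[ta tb]; rewrite ne ?gt1 // normr0 mul0r.
have kr : (64 * k.+1 ^ 2 <= r)%N.
  by rewrite leqNgt; apply/negP => /mink; rewrite ltnn.
have [|w [w0 w1 w2 w3]] := @dual_weight K R k.+1 s isT (leq_trans kr rR) s0.
  have hk : 8 * k.+1%:R <= Num.sqrt r%:R :> K.
    rewrite -(@ger0_norm _ (8 * k.+1%:R)) ?mulr_ge0 // -sqrtr_sqr ler_sqrt //.
    by rewrite exprMn -natrX -natrX -natrM ler_nat.
  have sq : s * (16 * Num.sqrt r%:R) = 1 by rewrite mulVf // gt_eqF; lra.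
  by have := ler_wpM2l s0 hk; lra.
exists k.+2, w; split=> //; split=> // e ek; apply: w2.
by apply: leq_trans ek _.
Qed.

(** The geometric lower bounds are those required by [coord_deforms_pos]; the exponential moments
    control the tail of the weight. *)
Record good_laws (k0 : nat) (s : K) (l0 l1 : T -> K) : Prop := GoodLaws {
  gl_ge0_0 : forall t, 0 <= l0 t;
  gl_ge0_1 : forall t, 0 <= l1 t;
  gl_sum_0 : \sum_t l0 t = 1;
  gl_sum_1 : \sum_t l1 t = 1;
  gl_at0_1 : l1 ord0 = 0;
  gl_at0_0 : 3 / 5 <= l0 ord0;
  gl_low_0 : forall t : T, (0 < t)%N -> 8 ^- t / 2 <= l0 t;
  gl_low_1 : forall t : T, (0 < t)%N -> 8 ^- t / 2 <= l1 t;
  gl_moments : forall e, (e < k0)%N ->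
     \sum_t l1 t * coord_ev K e t = \sum_t l0 t * coord_ev K e t;
  gl_exp_0 : \sum_t l0 t * expR (s * (t : nat)%:R) <= 1 + 9 * s;
  gl_exp_1 : \sum_t l1 t * expR (s * (t : nat)%:R) <= 1 + 9 * s }.

Lemma geometric_sum_le (q : K) (n : nat) : 0 <= q <= 1 / 2 ->
  \sum_(i < n) q ^+ i.+1 <= q / (1 - q).
Proof.
move=> /andP[q0 q1]; have h : 0 < 1 - q by lra.
rewrite ler_pdivlMr //; have -> : (\sum_(i < n) q ^+ i.+1) * (1 - q) = q - q ^+ n.+1.
  elim: n => [|n IH]; first by rewrite big_ord0 mul0r expr1 subrr.
  by rewrite big_ord_recr /= mulrDl IH !exprS; ring.
by rewrite lerBlDr lerDl exprn_ge0.
Qed.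

(** The laws are the positive and negative parts of [w], each increased by [eta] to obtain the lower
    bounds and divided by the common mass [Q]; their difference is $w/Q$. *)
Lemma dual_good_laws (k0 : nat) (s : K) (w : T -> K) :
  (0 < R)%N -> (0 < k0)%N -> 0 <= s -> s <= 1 / 16 -> is_dual k0 s w ->
  exists l0 l1, good_laws k0 s l0 l1.
Proof.
move=> R0 k00 s0 s1 [w0 wmass wmom wexp].
pose eta (t : T) : K := if t == ord0 then 0 else 8^-1 ^+ t.
have eta_ge0 t : 0 <= eta t.
  by rewrite /eta; case: ifP => // _; rewrite exprn_ge0 ?invr_ge0.
have eta_sum : \sum_t eta t <= 1 / 7.
  rewrite big_ord_recl /= {1}/eta eqxx add0r.
  rewrite (eq_bigr (fun i : 'I_R => 8^-1 ^+ i.+1)) => [|i _]; last by [].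
  have -> : 1 / 7 = 8^-1 / (1 - 8^-1) :> K by field.
  by apply: geometric_sum_le; lra.
have es2 : expR s <= 2 by have := @expR_sub1_le K s; rewrite s0 => /(_ _) h; lra.
(* Since $t\le2^t$ and $e^s\le2$, $e^{st}-1\le st\,e^{st}\le s4^t$, and the factor $8^{-t}$ leaves
   $s2^{-t}$. *)
have eta_exp : \sum_t eta t * (expR (s * (t : nat)%:R) - 1) <= s.
  rewrite big_ord_recl /= {1}/eta eqxx mul0r add0r.
  apply: (@le_trans _ _ (\sum_(i < R) s * 2^-1 ^+ i.+1)); last first.
    rewrite -mulr_sumr -[leRHS]mulr1 ler_wpM2l //.
    rewrite [leRHS](_ : 1 = 2^-1 / (1 - 2^-1)); last by field.
    by apply: geometric_sum_le; lra.
  apply: ler_sum => i _; rewrite /eta /= /bump leq0n add1n.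
  set t := i.+1; have := expR_1B_le (s * t%:R) => h1.
  have h2 : expR (s * t%:R) <= 2 ^+ t.
    by rewrite mulrC expRM_natl lerXn2r ?nnegrE ?expR_ge0.
  have h3 : t%:R <= 2 ^+ t :> K by rewrite -natrX ler_nat ltnW // ltn_expl.
  have st0 : 0 <= s * t%:R by rewrite mulr_ge0.
  have h4 : expR (s * t%:R) - 1 <= s * 2 ^+ t * 2 ^+ t.
    apply: (@le_trans _ _ (s * t%:R * expR (s * t%:R))); first by lra.
    by apply: ler_pM; rewrite ?expR_ge0 // ler_wpM2l.
  apply: le_trans (ler_wpM2l _ h4) _; first by rewrite exprn_ge0 ?invr_ge0.
  rewrite le_eqVlt; apply/orP; left; apply/eqP.
  by rewrite -(mulrA s) mulrCA -!exprMn; congr (_ * _ ^+ _); field.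
have wsum : \sum_t w t = 0.
  by rewrite -[RHS](wmom 0%N) //; apply: eq_bigr => t _; rewrite /coord_ev expr0 mulr1.
pose wp (t : T) := Num.max (w t) 0; pose wm (t : T) := Num.max (- w t) 0.
have wpm t : wp t - wm t = w t.
  by rewrite /wp /wm; case: (leP (w t) 0) => h1; case: (leP (- w t) 0) => h2; lra.
have wp0 t : 0 <= wp t by rewrite le_max lexx orbT.
have wm0 t : 0 <= wm t by rewrite le_max lexx orbT.
have wp_le t : wp t <= `|w t| by rewrite ge_max normr_ge0 ler_norm.
have wm_le t : wm t <= `|w t| by rewrite ge_max normr_ge0 -normrN ler_norm.
pose Q := \sum_t (wp t + eta t).
have QE : \sum_t (wm t + eta t) = Q.
  apply/eqP; rewrite eq_sym -subr_eq0 -sumrB -[X in _ == X]wsum; apply/eqP.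
  by apply: eq_bigr => t _; rewrite -wpm; ring.
have R1 : (1 < R.+1)%N by rewrite ltnS.
pose o1 : T := Ordinal R1.
have split2 (F : T -> K) : \sum_t F t = F ord0 + (F o1 + \sum_(t : T | (1 < t)%N) F t).
  rewrite (bigD1 ord0) //= (bigD1 o1) //=; congr (_ + (_ + _)).
  by apply: eq_bigl => -[[|[|t]] ht].
have w1 : w o1 <= 0.
  have := wsum; rewrite split2 w0 => h.
  have h2 : `|\sum_(t : T | (1 < t)%N) w t| <= \sum_(t : T | (1 < t)%N) `|w t|.
    exact: ler_norm_sum.
  by have := lerNnormlW h2; lra.
have Q1 : 1 <= Q.
  rewrite /Q (bigD1 ord0) //= {1}/wp w0 (max_idPl _) // {1}/eta eqxx addr0 lerDl.
  by apply: sumr_ge0 => t _; rewrite addr_ge0.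
(* The positive part has mass 1 at 0, none at 1 by [w1] and at most $1/2$ beyond;
   $\frac32+\frac17<\frac53$. *)
have Q53 : Q <= 5 / 3.
  rewrite /Q big_split /= split2 {1}/wp w0 (max_idPl _) // {1}/wp (max_idPr _) //.
  have : \sum_(t : T | (1 < t)%N) wp t <= 1 / 2.
    by apply: le_trans wmass; apply: ler_sum.
  by lra.
have Q0 : 0 < Q by lra.
have iQ : 3 / 5 <= Q^-1.
  by rewrite -[leRHS]mul1r ler_pdivlMr //; lra.
have iQ1 : Q^-1 <= 1 by rewrite invf_le1.
have low (u : T -> K) (t : T) : (forall t, 0 <= u t) -> (0 < t)%N ->
    8 ^- t / 2 <= (u t + eta t) / Q.
  move=> u0 t0; have et : eta t = 8 ^- t.
    by rewrite /eta -(inj_eq val_inj) /= (gtn_eqF t0) exprVn.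
  have e0 : 0 <= 8 ^- t :> K by rewrite -et.
  rewrite et; apply: ler_pM => //; first by rewrite lerDr.
  by apply: le_trans iQ; lra.
have total (u : T -> K) : \sum_t (u t + eta t) = Q -> \sum_t (u t + eta t) / Q = 1.
  by move=> uQ; rewrite -mulr_suml uQ mulfV // gt_eqF.
have exp_le (u : T -> K) : (forall t, 0 <= u t) -> (forall t, u t <= `|w t|) ->
    \sum_t (u t + eta t) = Q ->
    \sum_t (u t + eta t) / Q * expR (s * (t : nat)%:R) <= 1 + 9 * s.
  move=> u0 uw uQ; have X0 (t : T) : 0 <= expR (s * (t : nat)%:R) - 1.
    by rewrite subr_ge0 expR_ge1 // mulr_ge0.
  have -> : \sum_t (u t + eta t) / Q * expR (s * (t : nat)%:R) =
      1 + \sum_t (u t + eta t) / Q * (expR (s * (t : nat)%:R) - 1).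
    rewrite -[X in _ = X + _](total u uQ) -big_split /=; apply: eq_bigr => t _.
    by rewrite mulrBr mulr1 addrC subrK.
  rewrite lerD2l; apply: (@le_trans _ _ (\sum_t (`|w t| *
    (expR (s * (t : nat)%:R) - 1) + eta t * (expR (s * (t : nat)%:R) - 1)))).
    apply: ler_sum => t _; rewrite -mulrDl ler_wpM2r //.
    apply: (@le_trans _ _ (u t + eta t)); last by rewrite lerD2r.
    by rewrite ler_piMr // addr_ge0.
  by rewrite big_split /=; lra.
exists (fun t => (wp t + eta t) / Q), (fun t => (wm t + eta t) / Q); split.
- by move=> t; rewrite divr_ge0 ?addr_ge0 // ltW.
- by move=> t; rewrite divr_ge0 ?addr_ge0 // ltW.
- exact: total.
- exact: total.
- by rewrite /wm w0 (max_idPr _) ?oppr_le0 // /eta eqxx addr0 mul0r.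
- by rewrite /wp w0 (max_idPl _) // /eta eqxx addr0 mul1r.
- by move=> t; apply: low.
- by move=> t; apply: low.
- move=> e ek; apply/eqP; rewrite eq_sym -subr_eq0 -sumrB.
  rewrite (eq_bigr (fun t => w t * coord_ev K e t / Q)) => [|t _].
    by rewrite -mulr_suml wmom // mul0r.
  by rewrite -wpm; ring.
- exact: exp_le.
- exact: exp_le.
Qed.

Lemma exists_good_laws (r : nat) : (0 < r)%N -> (r <= R)%N ->
  exists k0 l0 l1, [/\ (0 < k0)%N, Num.sqrt r%:R <= 8 * k0%:R :> K
    & good_laws k0 (16 * Num.sqrt r%:R)^-1 l0 l1].
Proof.
move=> r0 rR; have [k0 [w [k00 rk0 wd]]] := exists_dual r0 rR.
have q1 : 1 <= Num.sqrt r%:R :> K by rewrite -[leLHS]sqrtr1 ler_sqrt ?ler1n.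
have [||l0 [l1 l01]] := dual_good_laws (leq_trans r0 rR) k00 _ _ wd.
- by rewrite invr_ge0 mulr_ge0.
- by rewrite invfM div1r ler_piMr ?invr_ge0 // invf_le1 // (lt_le_trans ltr01).
by exists k0, l0, l1.
Qed.

End Laws.

(** * Gordan's alternative *)

Section Gordan.
Variable K : realFieldType.

Lemma exists_between (A B : finType) (f : A -> K) (g : B -> K) :
  (forall a b, f a < g b) -> exists c, (forall a, f a < c) /\ (forall b, c < g b).
Proof.
move=> fg; have [a0 _|noA] := pickP (pred_of_simpl (@predT A)); last first.
  have [b0 _|noB] := pickP (pred_of_simpl (@predT B)); last first.
    by exists 0; split=> [a|b]; [have := noA a | have := noB b].
  exists (g [arg min_(b < b0) g b]%O - 1); split=> [a|b]; first by have := noA a.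
  by case: arg_minP => // i _ /(_ b isT) h; rewrite ltrBlDr (le_lt_trans h) // ltrDl.
pose a1 := [arg max_(a > a0) f a]%O.
have a1P a : f a <= f a1 by rewrite /a1; case: arg_maxP => // i _ /(_ a isT).
have [b0 _|noB] := pickP (pred_of_simpl (@predT B)); last first.
  exists (f a1 + 1); split=> [a|b]; last by have := noB b.
  by rewrite (le_lt_trans (a1P a)) // ltrDl.
pose b1 := [arg min_(b < b0) g b]%O.
have b1P b : g b1 <= g b by rewrite /b1; case: arg_minP => // i _ /(_ b isT).
have h := fg a1 b1; exists ((f a1 + g b1) / 2); split=> [a|b].
  by rewrite (le_lt_trans (a1P a)) // midf_lt.
by rewrite (lt_le_trans _ (b1P b)) // midf_lt.
Qed.

(* Fourier-Motzkin elimination of the last of the [k.+1] vectors: the points of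
   the new index type are the zeros of that vector and the pairs of points where
   it has opposite signs. *)
Lemma gordan (k : nat) (X : finType) (u : 'I_k -> X -> K) : (0 < #|X|)%N ->
  (exists nu : X -> K, [/\ forall x, 0 <= nu x, \sum_x nu x = 1
     & forall j, \sum_x nu x * u j x = 0]) \/
  (exists c : 'I_k -> K, forall x, 0 < \sum_j c j * u j x).
Proof.
elim: k X u => [|k IH] X u X0.
  have [x0 _] : exists x0 : X, x0 \in X by apply/card_gt0P.
  left; exists (fun x => (x == x0)%:R); split=> [x||[]//]; first by [].
  by rewrite (bigD1 x0) //= eqxx big1 ?addr0 // => x /negPf ->.
pose v := u ord_max.
pose Z := {x : X | v x == 0}; pose P := {x : X | 0 < v x}; pose N := {x : X | v x < 0}.
pose X' : finType := (Z + P * N)%type.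
pose w (j : 'I_k) := u (widen_ord (leqnSn k) j).
pose u' (j : 'I_k) (y : X') : K :=
  match y with
  | inl z => w j (val z)
  | inr pn => w j (val pn.1) * - v (val pn.2) + w j (val pn.2) * v (val pn.1)
  end.
have [X'0|] := posnP #|X'|; last first.
  move=> /(IH _ u')[[nu [nu0 nu1 nuu]]|[c cP]].
    left.
    (* [m y] is the nonnegative combination of point masses through which [u'] is built from [w]; it
       annihilates [v]. *)
    pose m (y : X') (x : X) : K := match y with
      | inl z => (x == val z)%:R
      | inr pn => (x == val pn.1)%:R * - v (val pn.2) + (x == val pn.2)%:R * v (val pn.1)
      end.
    pose mu x := \sum_y nu y * m y x.
    have sumd (x0 : X) (g : X -> K) : \sum_x (x == x0)%:R * g x = g x0.
      rewrite (bigD1 x0) //= eqxx mul1r big1 ?addr0 // => x /negPf ->.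
      by rewrite mul0r.
    have mE y (g : X -> K) : \sum_x m y x * g x = match y with
      | inl z => g (val z)
      | inr pn => g (val pn.1) * - v (val pn.2) + g (val pn.2) * v (val pn.1)
      end.
      case: y => [z|[p q]] /=; first exact: sumd.
      under eq_bigr do rewrite mulrDl !(mulrAC _ _ (g _)).
      by rewrite big_split /= -!mulr_suml !sumd.
    have muE (g : X -> K) : \sum_x mu x * g x = \sum_y nu y * \sum_x m y x * g x.
      under eq_bigr do rewrite mulr_suml; rewrite exchange_big /=.
      by apply: eq_bigr => y _; rewrite mulr_sumr; apply: eq_bigr => x _; rewrite mulrA.
    have m_ge0 y x : 0 <= m y x.
      case: y => [z|[[p hp] [q hq]]] //=.
      by rewrite addr_ge0 // mulr_ge0 // ?oppr_ge0 ltW.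
    have mu0 x : 0 <= mu x by apply: sumr_ge0 => y _; rewrite mulr_ge0.
    pose M := \sum_x mu x.
    have M0 : 0 < M.
      have ME : M = \sum_y nu y * \sum_x m y x.
        rewrite /M; have := muE (fun => 1); under eq_bigr do rewrite mulr1.
        move=> ->; apply: eq_bigr => y _; congr (_ * _).
        by apply: eq_bigr => x _; rewrite mulr1.
      have my y : 0 < \sum_x m y x.
        have := mE y (fun => 1); under eq_bigr do rewrite mulr1; move=> ->.
        case: y => [z|[[p hp] [q hq]]] //=.
        by rewrite !mul1r addr_gt0 // oppr_gt0.
      rewrite lt_neqAle eq_sym; apply/andP; split; last exact: sumr_ge0.
      apply: contra_eq_neq nu1 => M0; rewrite big1 ?(eq_sym 0) ?oner_eq0 // => y _.
      have /eqP := M0; rewrite ME psumr_eq0 => [/allP/(_ y)|y' _]; last first.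
        by rewrite mulr_ge0 // ltW.
      rewrite mem_index_enum => /(_ isT) /=; rewrite mulf_eq0 (gt_eqF (my y)) orbF.
      by move/eqP.
    exists (fun x => mu x / M); split.
    - by move=> x; rewrite divr_ge0 // ltW.
    - by rewrite -mulr_suml mulfV // gt_eqF.
    move=> j; under eq_bigr do rewrite mulrAC.
    rewrite -mulr_suml muE; apply/eqP; rewrite mulf_eq0; apply/orP; left; apply/eqP.
    have [j'|->] := unliftP ord_max j.
      move=> jj; rewrite -[RHS](nuu j'); apply: eq_bigr => y _; congr (_ * _).
      have -> : u j = w j'.
        rewrite jj /w; congr u; apply: val_inj; rewrite /= /bump leqNgt ltn_ord.
        by rewrite add0n.
      by rewrite mE.
    apply: big1 => y _; rewrite mE -/v; case: y => [[z hz]|[p q]] /=.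
      by rewrite (eqP hz) mulr0.
    by rewrite mulrN [v (val q) * _]mulrC addNr mulr0.
  right.
  pose W x := \sum_j c j * w j x.
  have WZ (z : Z) : 0 < W (val z) by have := cP (inl z).
  have WPN (p : P) (q : N) : 0 < W (val p) * - v (val q) + W (val q) * v (val p).
    have := cP (inr (p, q)); rewrite /= /W !mulr_suml -big_split /=.
    by under eq_bigr do rewrite mulrDr !mulrA.
  (* The coefficient of the eliminated vector: points with positive [v] bound it below, points with
     negative [v] above, and [WPN] makes these bounds compatible. *)
  have [l [l1 l2]] : exists l, (forall p : P, - W (val p) / v (val p) < l) /\
      (forall q : N, l < W (val q) / - v (val q)).
    apply: exists_between => p q; have hp := valP p; have hq := valP q.
    rewrite ltr_pdivrMr // mulrAC ltr_pdivlMr ?oppr_gt0 //.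
    by have := WPN p q; rewrite mulNr => h; lra.
  exists (fun j => if unlift ord_max j is Some j' then c j' else l) => x.
  rewrite big_ord_recr /= unlift_none -/v.
  rewrite (eq_bigr (fun j => c j * w j x)) => [|j _]; last first.
    have -> : widen_ord (leqnSn k) j = lift ord_max j.
      by apply: val_inj; rewrite /= /bump leqNgt ltn_ord add0n.
    rewrite liftK; congr (_ * u _ x); apply: val_inj => /=.
    by rewrite /bump leqNgt ltn_ord add0n.
  rewrite -/(W x); have [vx|vx|vx] := ltgtP (v x) 0.
  - have := l2 (exist _ x vx); rewrite /= ltr_pdivlMr ?oppr_gt0 // => h; lra.
  - have := l1 (exist _ x vx); rewrite /= ltr_pdivrMr // => h; lra.
  have := WZ (exist _ x (introT eqP vx)).
  by rewrite /= vx mulr0 addr0.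
(* No zeros and no pairs of opposite signs: [v] has constant strict sign, so a multiple of it is
   already positive. *)
right.
have noX' (y : X') : False by have := max_card (pred1 y); rewrite card1 X'0.
have nz x : v x != 0 by apply/negP => h; apply: (noX' (inl (exist _ x h))).
have [x0 _] : exists x0 : X, x0 \in X by apply/card_gt0P.
have [e ev] : exists e : K, forall x, 0 < e * v x.
  have [v0|v0|v0] := ltgtP (v x0) 0; last by have := nz x0; rewrite v0 eqxx.
    exists (-1) => x; have [vx|vx|vx] := ltgtP (v x) 0.
    - by rewrite mulN1r oppr_gt0.
    - by case: (noX' (inr (exist _ x vx, exist _ x0 v0))).
    - by have := nz x; rewrite vx eqxx.
  exists 1 => x; have [vx|vx|vx] := ltgtP (v x) 0.
  - by case: (noX' (inr (exist _ x0 v0, exist _ x vx))).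
  - by rewrite mul1r.
  - by have := nz x; rewrite vx eqxx.
exists (fun j => if j == ord_max then e else 0) => x.
rewrite (bigD1 ord_max) //= eqxx big1 ?addr0 // => j /negPf ->.
by rewrite mul0r.
Qed.

End Gordan.

(** Gordan's alternative is applied to $(1-\delta)u_j+\delta\sum_xL(x)u_j(x)$. A law $\nu$
    orthogonal to these functions yields $(1-\delta)\nu+\delta L$, which is orthogonal to the
    $u_j$. *)
Lemma gordan_smooth (K : realType) (k : nat) (X : finType) (u : 'I_k -> X -> K)
    (L : X -> K) (delta : K) : is_distr L -> 0 <= delta <= 1 ->
  (exists Lam : X -> K, [/\ is_distr Lam, forall x, delta * L x <= Lam x
     & forall j, \sum_x Lam x * u j x = 0]) \/
  (exists c : 'I_k -> K, forall x, 0 < (1 - delta) * (\sum_j c j * u j x) +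
     delta * \sum_x' L x' * \sum_j c j * u j x').
Proof.
move=> [L0 L1] /andP[d0 d1].
have X0 : (0 < #|X|)%N.
  rewrite lt0n; apply/eqP => /card0_eq h; move: L1; rewrite big1 => [/eqP|x _].
    by rewrite eq_sym oner_eq0.
  by have := h x.
pose u' (j : 'I_k) (x : X) := (1 - delta) * u j x + delta * \sum_x' L x' * u j x'.
have [[nu [nu0 nu1 nuu]]|[c cP]] := gordan u' X0.
  left; exists (fun x => (1 - delta) * nu x + delta * L x); split.
  - split=> [x|]; first by rewrite addr_ge0 // mulr_ge0 // subr_ge0.
    by rewrite big_split /= -!mulr_sumr nu1 L1; ring.
  - by move=> x; rewrite lerDr mulr_ge0 // subr_ge0.
  move=> j; rewrite -[RHS](nuu j) /u'.
  under [RHS]eq_bigr do rewrite mulrDr.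
  rewrite [RHS]big_split /= -[X in _ = _ + X]mulr_suml nu1 mul1r mulr_sumr.
  by rewrite -big_split /=; apply: eq_bigr => x _; ring.
right; exists c => x; have := cP x; rewrite /u'; congr (0 < _).
under eq_bigr do rewrite mulrDr.
rewrite big_split /= mulr_sumr; congr (_ + _).
  by apply: eq_bigr => j _; rewrite mulrCA.
under [in RHS]eq_bigr do rewrite mulr_sumr; rewrite exchange_big /= mulr_sumr.
apply: eq_bigr => j _; rewrite mulrCA mulr_sumr; congr (_ * _).
by apply: eq_bigr => x' _; rewrite mulrCA.
Qed.

(** * Averaging over the composed law *)

Section Composition.
Variables (K : realType) (R m n theta : nat) (l0 l1 : 'I_R.+1 -> K).
Variables (k0 : nat) (s : K).
Local Notation T := 'I_R.+1.
Local Notation X := {ffun 'I_m -> T}.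
Local Notation Z := {ffun 'I_n -> X}.
Hypotheses (n_gt0 : (0 < n)%N) (m_gt0 : (0 < m)%N) (R_gt0 : (0 < R)%N).
Hypothesis s_ge0 : 0 <= s.
Hypothesis gl : good_laws k0 s l0 l1.

Local Notation blk := (@block_law K R m l0 l1).
Definition weight_of (x : Z) : nat := \sum_i \sum_j x i j.
Definition pattern (x : Z) : cube n := [ffun i => MPstar (x i)].
Definition comp_law (y : cube n) : Z -> K := tens (fun i => blk (y i)).

Lemma blk_ge0 b x : 0 <= blk b x.
Proof.
exact: block_law_ge0 (gl_ge0_0 gl) (gl_ge0_1 gl) (gl_sum_0 gl) (gl_at0_1 gl)
  (gl_at0_0 gl) b x.
Qed.

Lemma blk_sum b : \sum_x blk b x = 1.
Proof. exact: block_law_sum m_gt0 (gl_sum_0 gl) (gl_sum_1 gl) b. Qed.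

Lemma comp_law_ge0 y x : 0 <= comp_law y x.
Proof. by apply: tens_ge0 => i z; apply: blk_ge0. Qed.

Lemma comp_law_sum y : \sum_x comp_law y x = 1.
Proof. by apply: tens_total => i; apply: blk_sum. Qed.

Lemma comp_law_off y x : y != pattern x -> comp_law y x = 0.
Proof.
move=> ne; have [i yi] : exists i, y i != pattern x i.
  apply/existsP; apply: contraNT ne; rewrite negb_exists => /forallP h.
  by apply/eqP/ffunP => i; apply/eqP/negbNE.
rewrite /comp_law /tens (bigD1 i) //= block_law_off ?mul0r //.
  exact: gl_at0_1 gl.
by rewrite ffunE in yi.
Qed.

(** For [b = false] the domination by [2 * tens l0] is applied to the exponential minus 1, so the
    factor 2 costs only a doubled exponent, $18=2\cdot9$. *)
Lemma blk_exp b : \sum_x blk b x * expR (s * (\sum_j x j)%N%:R) <=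
  expR (18 * s) ^+ m.
Proof.
have U1 : 1 + 9 * s <= expR (9 * s) := expR_ge1Dx _.
have expE (x : X) : expR (s * (\sum_j x j)%N%:R) =
    \prod_j expR (s * (x j : nat)%:R) :> K.
  by rewrite -expR_sum natr_sum mulr_sumr.
have tensE (l : T -> K) : \sum_(x : X) tens (fun _ => l) x * expR (s * (\sum_j x j)%N%:R)
    = (\sum_t l t * expR (s * (t : nat)%:R)) ^+ m.
  under eq_bigr do rewrite expE /tens -big_split /=.
  rewrite -(bigA_distr_bigA (fun _ t => l t * expR (s * (t : nat)%:R))).
  by rewrite prodr_const card_ord.
have e18 : expR (18 * s) ^+ m = (expR (9 * s) ^+ m) ^+ 2.
  by rewrite -expRM_natl -expRM_natl -expRM_natl; congr expR; ring.
have U0 : 1 <= expR (9 * s) ^+ m by rewrite exprn_ege1 // expR_ge1 // mulr_ge0.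
case: b.
  rewrite /= tensE e18; apply: (@le_trans _ _ (expR (9 * s) ^+ m)).
    rewrite lerXn2r ?nnegrE ?expR_ge0 //.
      apply: sumr_ge0 => t _; rewrite mulr_ge0 ?expR_ge0 //; exact: gl_ge0_1 gl _.
    exact: le_trans (gl_exp_1 gl) U1.
  by rewrite expr2 ler_peMl // (le_trans ler01).
set U := (\sum_t l0 t * expR (s * (t : nat)%:R)) ^+ m.
have UU : U <= expR (9 * s) ^+ m.
  rewrite lerXn2r ?nnegrE ?expR_ge0 //.
    apply: sumr_ge0 => t _; rewrite mulr_ge0 ?expR_ge0 //; exact: gl_ge0_0 gl _.
  exact: le_trans (gl_exp_0 gl) U1.
have U1' : 1 <= U.
  rewrite exprn_ege1 // -[leLHS](gl_sum_0 gl); apply: ler_sum => t _.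
  by rewrite ler_peMr ?expR_ge1 ?mulr_ge0 //; apply: gl_ge0_0 gl _.
(* [1 + 2 (U - 1) <= U ^ 2] absorbs the factor 2 of [block_law_false_le]. *)
apply: (@le_trans _ _ (1 + 2 * (U - 1))); last first.
  apply: (@le_trans _ _ (U ^+ 2)); first by nra.
  by rewrite e18 lerXn2r ?nnegrE //; lra.
have t1 : \sum_(x : X) tens (fun _ => l0) x = 1.
  by apply: tens_total => _; apply: gl_sum_0 gl.
rewrite -lerBlDl -[X in _ - X](blk_sum false) -sumrB /U -tensE -[X in _ - X]t1.
rewrite -sumrB mulr_sumr; apply: ler_sum => x _.
rewrite -[X in _ - X]mulr1 -mulrBr -[X in 2 * (_ - X)]mulr1 -mulrBr mulrA.
rewrite ler_wpM2r // ?subr_ge0 ?expR_ge1 ?mulr_ge0 //.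
exact: block_law_false_le (gl_ge0_0 gl) (gl_sum_0 gl) (gl_at0_1 gl) (gl_at0_0 gl) _.
Qed.

(** Chernoff's bound, the blocks being independent. *)
Lemma comp_law_tail (y : cube n) :
  \sum_(x | (theta < weight_of x)%N) comp_law y x <=
  expR (18 * s * (n * m)%:R - s * theta%:R).
Proof.
have E1 : \sum_x comp_law y x * expR (s * (weight_of x)%:R) <=
    expR (18 * s * (n * m)%:R).
  have -> : \sum_x comp_law y x * expR (s * (weight_of x)%:R) =
      \prod_i \sum_z blk (y i) z * expR (s * (\sum_j z j)%N%:R).
    rewrite bigA_distr_bigA; apply: eq_bigr => x _.
    rewrite /comp_law /tens /weight_of natr_sum mulr_sumr expR_sum -big_split /=.
    by [].
  have -> : expR (18 * s * (n * m)%:R) = \prod_(i < n) expR (18 * s) ^+ m.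
    by rewrite prodr_const card_ord -exprM mulnC -expRM_natl mulrC.
  apply: ler_prod => i _; rewrite blk_exp andbT.
  by apply: sumr_ge0 => z _; rewrite mulr_ge0 ?blk_ge0 ?expR_ge0.
rewrite expRB ler_pdivlMr ?expR_gt0 //; apply: le_trans E1.
rewrite mulr_suml big_mkcond /=; apply: ler_sum => x _.
case: ifP => [tx|_]; last by rewrite mulr_ge0 ?comp_law_ge0 ?expR_ge0.
by rewrite ler_wpM2l ?comp_law_ge0 // ler_expR ler_wpM2l // ler_nat ltnW.
Qed.

Local Notation ev := (@all_ev K R m n).
Local Notation wd := (@all_wd m n).

(* The [i]-th factor of the moment depends on [y i] only if the degree in the
   [i]-th block reaches [minn m k0]. *)
Lemma comp_law_moment (phi : cube n -> K) (d : nat) (w : 'I_n -> 'I_m -> nat) :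
  (forall g : cube n, ((\sum_i g i) * minn m k0 < d)%N ->
     \sum_y phi y * \prod_i (y i : nat)%:R ^+ g i = 0) ->
  (wd w < d)%N ->
  \sum_y phi y * \sum_x comp_law y x * ev w x = 0.
Proof.
move=> hphi wdd.
pose A (i : 'I_n) (b : bool) := \sum_x blk b x * block_ev K (w i) x : K.
have AE y : \sum_x comp_law y x * ev w x = \prod_i A i (y i).
  by rewrite /comp_law /all_ev tens_pair.
(* Each factor is written as the affine function $A_i(0)+y_i(A_i(1)-A_i(0))$; expanding the product
   gives a multilinear polynomial in [y]. *)
pose F (i : 'I_n) (b : bool) : K := if b then A i true - A i false else A i false.
have prodE (y : cube n) : \prod_i A i (y i) =
    \sum_(g : cube n) (\prod_i F i (g i)) * \prod_i (y i : nat)%:R ^+ g i.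
  transitivity (\prod_i \sum_b F i b * (y i : nat)%:R ^+ nat_of_bool b).
    apply: eq_bigr => i _; rewrite big_bool /= expr1 expr0 mulr1 /F.
    by case: (y i); rewrite ?mulr1 ?subrK // mulr0 add0r.
  rewrite bigA_distr_bigA; apply: eq_bigr => g _; by rewrite big_split.
under eq_bigr do rewrite AE prodE mulr_sumr; rewrite exchange_big /=.
apply: big1 => g _; have [hg|hg] := ltnP ((\sum_i g i) * minn m k0) d.
  under eq_bigr do rewrite mulrCA; rewrite -mulr_sumr hphi ?mulr0 //.
have [i /andP[gi wi]] : exists i, g i && (block_wd (w i) < minn m k0)%N.
  apply/existsP; apply: contraTT wdd; rewrite negb_exists -leqNgt => /forallP h.
  apply: leq_trans hg _; rewrite big_distrl /=; apply: leq_sum => i _.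
  have := h i; case: (g i) => //=; first by rewrite -leqNgt mul1n.
have Fi : F i (g i) = 0.
  rewrite gi /F /A.
  by rewrite (block_law_moments (gl_sum_0 gl) (gl_moments gl) wi) subrr.
rewrite big1 // => y _; rewrite (bigD1 i) //= Fi !mul0r mulr0 //.
Qed.

Variable d : nat.
Let B : K := 2 * (42 * 257 * (n * m * R)%:R) ^+ d.
Variables (J : finType) (c : J -> K) (w : J -> 'I_n -> 'I_m -> nat).
Hypothesis wd_lt : forall j, (wd (w j) < d)%N.
Let p (x : Z) : K := \sum_j c j * ev (w j) x.

Let B_ge0 : 0 <= B.
Proof. by rewrite /B -!natrM -natrX -natrM ler0n. Qed.

Lemma comp_law_bound (y : cube n) (x : Z) : pattern x = y ->
  `|p x| <= B * \sum_z comp_law y z * `|p z|.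
Proof.
move=> xy; rewrite /B /comp_law; apply: (anticoncentration n_gt0 m_gt0 R_gt0
  (gl_ge0_0 gl) (gl_ge0_1 gl) (gl_sum_0 gl) (gl_sum_1 gl)
  (gl_at0_0 gl) (gl_low_0 gl) (gl_low_1 gl)
  (b := fun i => blk (y i)) (c := c) (w := w) (d := d) (p := p)) => //.
- by move=> i z; apply: blk_ge0.
- by move=> i; apply: blk_sum.
- move=> i z; rewrite -xy ffunE /MPstar.
  have := blk_ge0 [forall i0, (0 < x i i0)%N] z; set q := blk _ _; lra.
by move=> j; apply: ltnW.
Qed.

Variables (f : cube n -> bool) (a : K).
Hypothesis a_ge0 : 0 <= a.
Hypothesis p_sign : forall x, (weight_of x <= theta)%N ->
  - a <= (-1) ^+ f (pattern x) * p x.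
Hypothesis tail_small : expR (18 * s * (n * m)%:R - s * theta%:R) * B <= 1 / 4.

Let E (y : cube n) : K := \sum_x comp_law y x * `|p x|.

(** Put $q=(-1)^fp$. For weight at most [theta], $q\ge-a$ gives $|q|-2a\le q$; beyond,
    $q\ge|q|-2|q|$. By [comp_law_bound] and [tail_small] the tail carries at most a quarter of
    $E|p|$, so half of $E|p|$ survives. *)
Lemma mean_abs_le (y : cube n) :
  E y <= 2 * ((-1) ^+ f y * \sum_x comp_law y x * p x) + 4 * a.
Proof.
have tail : \sum_(x | (theta < weight_of x)%N) comp_law y x * `|p x| <= 1 / 4 * E y.
  have E0 : 0 <= E y by apply: sumr_ge0 => x _; rewrite mulr_ge0 ?comp_law_ge0.
  have B0 := B_ge0.
  apply: (@le_trans _ _ (\sum_(x | (theta < weight_of x)%N) comp_law y x * (B * E y))).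
    apply: ler_sum => x _; have [->|ne] := eqVneq y (pattern x).
      by rewrite ler_wpM2l ?comp_law_ge0 //; apply: comp_law_bound.
    by rewrite comp_law_off ?mul0r.
  rewrite -mulr_suml mulrA; apply: ler_wpM2r => //.
  apply: le_trans tail_small; rewrite ler_wpM2r //; exact: comp_law_tail.
have : \sum_x comp_law y x * (`|p x| - 2 * a) -
    2 * \sum_(x | (theta < weight_of x)%N) comp_law y x * `|p x| <=
    (-1) ^+ f y * \sum_x comp_law y x * p x.
  rewrite mulr_sumr [X in _ - X]big_mkcond /= -sumrB mulr_sumr; apply: ler_sum => x _.
  have [yx|ne] := eqVneq y (pattern x); last first.
    by rewrite comp_law_off // !mul0r mulr0; case: ifP; rewrite ?mulr0 subr0.
  rewrite [leRHS]mulrCA; have L0 := comp_law_ge0 y x.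
  have nq : `|p x| = `|(-1) ^+ f y * p x|.
    by rewrite normrM normrX normrN1 expr1n mul1r.
  have := @p_sign x; rewrite -yx nq; move: ((-1) ^+ f y * p x) => q h.
  have a0 := a_ge0; case: ltnP => tx.
    rewrite [X in _ - X]mulrCA -mulrBr ler_wpM2l //.
    by have := lerNnormlW (lexx `|q|); lra.
  rewrite subr0 ler_wpM2l //; have {}h := h tx.
  by case: (ler0P q) => q0; lra.
under eq_bigr do rewrite mulrBr.
rewrite sumrB -mulr_suml comp_law_sum mul1r -/(E y) => h; lra.
Qed.

Variables (mu : cube n -> K) (gamma : K).
Hypothesis mu_distr : is_distr mu.
Hypothesis gamma_ge0 : 0 <= gamma.
Hypothesis mu_smooth : forall y, gamma * 2 ^- n <= mu y.
Hypothesis mu_orth : forall g : cube n, ((\sum_i g i) * minn m k0 < d)%N ->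
  \sum_y (-1) ^+ f y * mu y * \prod_i (y i : nat)%:R ^+ g i = 0.

(** Averaging [mean_abs_le] over [mu] removes the signed term by orthogonality. *)
Lemma mean_mean_abs_le : \sum_y mu y * E y <= 4 * a.
Proof.
have [mu0 mu1] := mu_distr.
have orth0 : \sum_y mu y * ((-1) ^+ f y * \sum_x comp_law y x * p x) = 0.
  have e1 y : mu y * ((-1) ^+ f y * \sum_x comp_law y x * p x) =
      \sum_j c j * ((-1) ^+ f y * mu y * \sum_x comp_law y x * ev (w j) x).
    rewrite mulrA [mu y * _]mulrC.
    under [RHS]eq_bigr do rewrite mulrCA; rewrite -mulr_sumr; congr (_ * _).
    under [RHS]eq_bigr do rewrite mulr_sumr; rewrite exchange_big /=.
    apply: eq_bigr => x _; rewrite /p mulr_sumr; apply: eq_bigr => j _.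
    by rewrite mulrCA.
  under eq_bigr do rewrite e1; rewrite exchange_big /=; apply: big1 => j _.
  by rewrite -mulr_sumr (@comp_law_moment _ d) ?mulr0.
apply: (@le_trans _ _ (\sum_y mu y *
   (2 * ((-1) ^+ f y * \sum_x comp_law y x * p x) + 4 * a))).
  by apply: ler_sum => y _; rewrite ler_wpM2l // mean_abs_le.
under eq_bigr do rewrite mulrDr mulrCA.
by rewrite big_split /= -mulr_sumr orth0 mulr0 add0r -mulr_suml mu1 mul1r.
Qed.

Lemma exists_small_point : (n * m <= theta)%N ->
  exists2 x : Z, (weight_of x <= theta)%N & `|p x| <= B * (4 * a).
Proof.
move=> nm; have [mu0 mu1] := mu_distr.
have B0 := B_ge0.
have /existsP[y Ey] : [exists y, E y <= 4 * a].
  apply: contraT; rewrite negb_exists => /forallP h.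
  have {}h y : 4 * a < E y by rewrite ltNge.
  have /existsP[y0 my0] : [exists y, 0 < mu y].
    apply: contraT; rewrite negb_exists => /forallP h0.
    have : \sum_y mu y <= 0 by apply: sumr_le0 => y _; rewrite leNgt.
    by rewrite mu1 ler10.
  have : \sum_y mu y * (4 * a) < \sum_y mu y * E y.
    rewrite (bigD1 y0) //= [ltRHS](bigD1 y0) //=; apply: ltr_leD.
      by rewrite ltr_pM2l.
    by apply: ler_sum => y _; rewrite ler_wpM2l // ltW.
  by rewrite -mulr_suml mu1 mul1r ltNge mean_mean_abs_le.
(* A point of pattern [y] whose weight is at most $nm$: blocks of ones and blocks of zeros. *)
pose x : Z := [ffun i => [ffun j => if y i then inord 1 else ord0]].
have o1 : (@inord R 1 : nat) = 1%N by rewrite inordK.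
exists x.
  apply: leq_trans nm; apply: (@leq_trans (\sum_(i < n) \sum_(j < m) 1)).
    apply: leq_sum => i _; apply: leq_sum => j _; rewrite !ffunE.
    by case: (y i); rewrite ?o1.
  by rewrite !sum_nat_const !card_ord muln1.
apply: le_trans (@comp_law_bound y x _) _; last by rewrite ler_wpM2l.
apply/ffunP => i; rewrite ffunE /MPstar; case yi: (y i).
  by apply/forallP => j; rewrite !ffunE yi o1.
apply/negbTE; rewrite negb_forall; apply/existsP; exists (Ordinal m_gt0).
by rewrite !ffunE yi.
Qed.

(** The product of the even mixtures of the two block laws is the uniform mixture of the laws
    [comp_law y], and smoothness gives $\gamma2^{-n}\le\mu(y)$. *)
Lemma smooth_pointwise_bound (x : Z) : gamma * `|p x| <= B * (4 * a).
Proof.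
have B0 := B_ge0.
pose b (i : 'I_n) (z : X) : K := 2^-1 * (blk true z + blk false z).
have bE (z : Z) : tens b z = \sum_y 2 ^- n * comp_law y z.
  transitivity (\prod_i \sum_(e : bool) 2^-1 * blk e (z i)).
    by apply: eq_bigr => i _; rewrite big_bool /= -mulrDr.
  rewrite bigA_distr_bigA; apply: eq_bigr => y _; rewrite big_split /=.
  by rewrite prodr_const card_ord exprVn.
have hx : `|p x| <= B * \sum_z tens b z * `|p z|.
  apply: (anticoncentration n_gt0 m_gt0 R_gt0
    (gl_ge0_0 gl) (gl_ge0_1 gl) (gl_sum_0 gl) (gl_sum_1 gl)
    (gl_at0_0 gl) (gl_low_0 gl) (gl_low_1 gl)
    (c := c) (w := w) (d := d) (p := p)) => //.
  - by move=> i z; apply: mulr_ge0; [rewrite invr_ge0 | apply: addr_ge0; apply: blk_ge0].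
  - move=> i; rewrite -mulr_sumr.
    have -> : \sum_z (blk true z + blk false z) = 1 + 1.
      by rewrite -[X in X + _](blk_sum true) -[X in _ + X](blk_sum false) big_split.
    by field.
  - move=> i z; rewrite /b mulrA mulfV // mul1r.
    by case: [forall _, _]; rewrite ?lerDl ?lerDr blk_ge0.
  by move=> j; apply: ltnW.
have bsum : \sum_z tens b z * `|p z| = \sum_y 2 ^- n * E y.
  under eq_bigr do rewrite bE mulr_suml; rewrite exchange_big /=.
  apply: eq_bigr => y _; rewrite /E mulr_sumr; apply: eq_bigr => z _.
  by rewrite mulrA.
apply: le_trans (ler_wpM2l gamma_ge0 hx) _; rewrite mulrCA ler_wpM2l //.
apply: le_trans mean_mean_abs_le; rewrite bsum mulr_sumr; apply: ler_sum => y _.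
rewrite mulrA ler_wpM2r //; apply: sumr_ge0 => z _.
by rewrite mulr_ge0 ?comp_law_ge0.
Qed.

End Composition.

(** * The theorem *)

Section Flattening.
Variables (K : realType) (n m R : nat).
Local Notation T := 'I_R.+1.

Lemma big_mxvec (A : Type) (idx : A) (op : Monoid.com_law idx)
    (F : 'I_(n * m) -> A) :
  \big[op/idx]_t F t = \big[op/idx]_(i < n) \big[op/idx]_(j < m) F (mxvec_index i j).
Proof.
by rewrite (reindex _ (curry_mxvec_bij n m)) pair_bigA /=; apply: eq_bigr => -[].
Qed.

Definition nest (x : {ffun 'I_(n * m) -> T}) : {ffun 'I_n -> {ffun 'I_m -> T}} :=
  [ffun i => block x i].

Definition unnest (z : {ffun 'I_n -> {ffun 'I_m -> T}}) : {ffun 'I_(n * m) -> T} :=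
  [ffun t => mxvec (\matrix_(i, j) z i j) ord0 t].

Lemma nestE x i j : nest x i j = x (mxvec_index i j).
Proof. by rewrite !ffunE. Qed.

Lemma unnestK : cancel unnest nest.
Proof.
by move=> z; apply/ffunP => i; apply/ffunP => j; rewrite nestE ffunE mxvecE mxE.
Qed.

Lemma weight_nest x : weight_of (nest x) = (\sum_t x t)%N.
Proof.
rewrite big_mxvec; apply: eq_bigr => i _; apply: eq_bigr => j _.
by rewrite nestE.
Qed.

Definition monomial (e : 'I_(n * m) -> nat) (x : {ffun 'I_(n * m) -> T}) : K :=
  \prod_t (x t : nat)%:R ^+ e t.

Definition nest_exp (e : 'I_(n * m) -> nat) (i : 'I_n) (j : 'I_m) : nat :=
  e (mxvec_index i j).

Lemma all_ev_nest e x : all_ev K (nest_exp e) (nest x) = monomial e x.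
Proof.
rewrite /monomial big_mxvec; apply: eq_bigr => i _; apply: eq_bigr => j _.
by rewrite /coord_ev nestE.
Qed.

Lemma all_wd_nest e : all_wd (nest_exp e) = (\sum_t e t)%N.
Proof. by rewrite [RHS]big_mxvec. Qed.

End Flattening.

(** * Numerical estimates *)

Section Numeric.
Variable K : realType.

Lemma ln2_le1 : ln 2 <= 1 :> K.
Proof.
rewrite -[leRHS]expRK ler_ln ?posrE ?expR_gt0 //.
by apply: le_trans (expR_ge1Dx 1); rewrite -natr1.
Qed.

Lemma ln2_gt0 : 0 < ln 2 :> K.
Proof. by rewrite ln_gt0 // ltr1n. Qed.

Lemma ln_le_log2 (x : K) : 1 <= x -> ln x <= log2 x.
Proof.
move=> x1; rewrite /log2 ler_pdivlMr ?ln2_gt0 // ler_piMr ?ln2_le1 //.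
exact: ln_ge0.
Qed.

Lemma log2_ge1 (x : K) : 2 <= x -> 1 <= log2 x.
Proof.
move=> x2; rewrite /log2 ler_pdivlMr ?ln2_gt0 // mul1r ler_ln ?posrE //.
exact: lt_le_trans x2.
Qed.

Lemma pow_42_257_le (X : K) (d : nat) : 0 <= X ->
  (42 * 257 * X) ^+ d <= (2 ^+ 14 * X) ^+ d.
Proof.
move=> X0; have h42 : 42 * 257 <= 2 ^+ 14 :> K.
  by rewrite -natrM -natrX ler_nat; lia.
apply: lerXn2r; rewrite ?nnegrE; last exact: ler_wpM2r.
  by apply: mulr_ge0 X0; apply: mulr_ge0; apply: ler0n.
by apply: mulr_ge0 X0; apply: exprn_ge0; apply: ler0n.
Qed.

(** $42\cdot257\le2^{14}$ and a factor 8 from the constants 2 and $1/4$ lead to $2^{17}$, hence the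
    17. *)
Lemma tail_times_bound (X q : K) (d : nat) : 1 <= X -> (0 < d)%N ->
  17 * d%:R * ln (2 * X) <= q ->
  expR (- q) * (2 * (42 * 257 * X) ^+ d) <= 1 / 4.
Proof.
move=> X1 d0 hq; have X0 : 0 < X := lt_le_trans ltr01 X1.
rewrite expRN mulrC ler_pdivrMr ?expR_gt0 //.
apply: (@le_trans _ _ (2 * (2 ^+ 14 * X) ^+ d)).
  by apply: ler_wpM2l => //; apply: pow_42_257_le; apply: ltW.
have e17 : expR (17 * d%:R * ln (2 * X)) = ((2 * X) ^+ 17) ^+ d.
  rewrite -mulrA expRM_natl mulrC expRM_natr lnK ?posrE ?mulr_gt0 //.
  by rewrite -!exprM mulnC.
apply: (@le_trans _ _ (1 / 4 * ((2 * X) ^+ 17) ^+ d)); last first.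
  by rewrite -e17 ler_wpM2l // ler_expR.
have h8 : 8 * (2 ^+ 14 * X) ^+ d <= ((2 * X) ^+ 17) ^+ d.
  apply: (@le_trans _ _ ((8 * (2 ^+ 14 * X)) ^+ d)).
    rewrite [leRHS]exprMn ler_wpM2r ?exprn_ge0 ?mulr_ge0 ?exprn_ge0 ?(ltW X0) //.
    by case: d d0 {hq e17} => // d _; rewrite exprS ler_peMr // exprn_ege1 // ler1n.
  rewrite lerXn2r ?nnegrE ?exprn_ge0 ?mulr_ge0 ?exprn_ge0 ?(ltW X0) //.
  rewrite exprMn mulrA -[8](_ : 2 ^+ 3 = 8 :> K) -?exprD; last by rewrite -natrX.
  rewrite ler_wpM2l ?exprn_ge0 // -[leLHS]expr1 ler_weXn2l //.
by move: h8; move: ((2 ^+ 14 * X) ^+ d) (((2 * X) ^+ 17) ^+ d) => u v h; lra.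
Qed.

(** $16\cdot2\le2^5$ and $5+14\le20$. The factor 16 turns the pointwise bound $4Ba$ into $a/4$. *)
Lemma bound_times_smooth (X : K) (d : nat) : 1 <= X -> (0 < d)%N ->
  16 * (2 * (42 * 257 * X) ^+ d) <= (2 ^+ 20 * X) ^+ (9 * d).
Proof.
move=> X1 d0; have X0 : 0 < X := lt_le_trans ltr01 X1.
apply: (@le_trans _ _ ((2 ^+ 20 * X) ^+ d)); last first.
  rewrite ler_weXn2l ?leq_pmull // -[leLHS]mulr1 ler_pM // exprn_ege1 //.
  by rewrite ler1n.
apply: (@le_trans _ _ (16 * 2 * (2 ^+ 14 * X) ^+ d)).
  rewrite mulrA; apply: ler_wpM2l; first by rewrite mulr_ge0.
  by apply: pow_42_257_le; apply: ltW.
apply: (@le_trans _ _ ((2 ^+ 5 * (2 ^+ 14 * X)) ^+ d)).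
  rewrite [leRHS]exprMn ler_wpM2r ?exprn_ge0 ?mulr_ge0 ?exprn_ge0 ?(ltW X0) //.
    case: d d0 => // d _; rewrite exprS -[leLHS]mulr1 ler_pM ?exprn_ge0 //.
      by rewrite -natrM -natrX ler_nat.
    by rewrite exprn_ege1 // exprn_ege1 // ler1n.
rewrite mulrA -exprD lerXn2r ?nnegrE ?mulr_ge0 ?exprn_ge0 ?(ltW X0) //.
by rewrite ler_wpM2r ?(ltW X0) // ler_weXn2l // ler1n.
Qed.

End Numeric.

(** * Orthogonality and the smooth threshold degree *)

Section OrthLemmas.
Variables (K : realType) (n : nat).

(** For positive [d], [tdeg p < d] amounts to [msize p <= d], the zero polynomial included. *)
Lemma orth_ge (N : nat) (X : finType) (coord : X -> 'I_N -> nat) (phi : X -> K)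
    (d : nat) :
  (forall p : mpoly N K, (msize p <= d)%N ->
     \sum_x phi x * meval (fun i => (coord x i)%:R) p = 0) ->
  (0 < d)%N -> ((d%:R)%:E <= orth coord phi)%E.
Proof.
move=> h d0; apply/ereal_infP => _ [p /= hp <-]; rewrite lee_fin ler_nat.
rewrite leqNgt; apply/negP => lt; move/eqP: hp; apply; apply: h.
by move: lt; rewrite /tdeg; case: (msize p).
Qed.

Lemma orth_gt_monomial (phi : cube n -> K) (q : K) (g : cube n) :
  (q%:E < orth (@cube_coord n) phi)%E -> (\sum_i g i)%N%:R <= q ->
  \sum_y phi y * \prod_i (y i : nat)%:R ^+ g i = 0.
Proof.
move=> hq gq; apply/eqP; apply: contraTT hq => ne; rewrite -leNgt.
pose mm := Multinom [tuple (nat_of_bool (g i)) | i < n].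
apply: (@le_trans _ _ ((\sum_i g i)%N%:R)%:E); last by rewrite lee_fin.
apply: ge_ereal_inf; exists ((tdeg (mpolyX K mm))%:R)%:E; last first.
  rewrite lee_fin ler_nat /tdeg msizeX /= mdegE.
  by apply: leq_sum => i _; rewrite mnmE.
exists (mpolyX K mm) => //=; apply: contraNneq ne => h; rewrite -[X in _ == X]h.
apply/eqP; apply: eq_bigr => y _; rewrite mevalX; congr (_ * _).
by apply: eq_bigr => i _; rewrite mnmE.
Qed.

End OrthLemmas.

(** The hypotheses make the smooth threshold degree exceed $d/\min(m,k_0)$; being a supremum, it has
    an admissible [mu] beyond that value. *)
Lemma smooth_witness (K : realType) (n m k0 r d : nat) (f : cube n -> bool)
    (gamma C : K) : (0 < m)%N -> (0 < k0)%N -> (0 < d)%N -> 8 < C ->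
  Num.sqrt r%:R <= 8 * k0%:R :> K ->
  ((C * d%:R)%:E <= (m%:R)%:E * smooth_thrdeg f gamma)%E ->
  ((C * d%:R)%:E <= (Num.sqrt r%:R)%:E * smooth_thrdeg f gamma)%E ->
  exists mu : cube n -> K, [/\ is_distr mu, forall y, gamma * 2 ^- n <= mu y &
    forall g : cube n, ((\sum_i g i) * minn m k0 < d)%N ->
      \sum_y (-1) ^+ f y * mu y * \prod_i (y i : nat)%:R ^+ g i = 0].
Proof.
move=> m0 k00 d0 C8 rk hm hr.
have d1 : 0 < (minn m k0)%:R :> K by rewrite ltr0n leq_min m0.
have dp : 0 < d%:R :> K by rewrite ltr0n.
have : ((d%:R / (minn m k0)%:R)%:E < smooth_thrdeg f gamma)%E.
  rewrite ltNge; apply/negP => le.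
  have h1 : C * d%:R <= m%:R * (d%:R / (minn m k0)%:R).
    rewrite -lee_fin; apply: le_trans hm _; rewrite EFinM.
    by apply: lee_wpmul2l; rewrite ?lee_fin.
  have h2 : C * d%:R <= Num.sqrt r%:R * (d%:R / (minn m k0)%:R).
    rewrite -lee_fin; apply: le_trans hr _; rewrite EFinM.
    by apply: lee_wpmul2l; rewrite ?lee_fin ?sqrtr_ge0.
  have [mk|mk] := leqP m k0.
    move: h1; rewrite (minn_idPl mk) mulrCA mulfV ?pnatr_eq0 -?lt0n // mulr1.
    by rewrite -[leRHS]mul1r ler_pM2r //; lra.
  move: h2; rewrite (minn_idPr (ltnW mk)) => h2.
  have : C * d%:R <= 8 * d%:R.
    apply: le_trans h2 _; rewrite mulrA ler_pdivrMr ?ltr0n // mulrAC.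
    by rewrite ler_wpM2r.
  by rewrite ler_pM2r //; lra.
move=> /ereal_sup_gt[_ [mu [mu1 mu2] <-] hmu].
exists mu; split=> // g hg; apply: orth_gt_monomial hmu _.
by rewrite ler_pdivlMr // -natrM ler_nat ltnW.
Qed.

Theorem theorem5p18 (K : realType) :
  exists C : K, 1 <= C /\
  forall (n m r R theta : nat),
    (0 < n)%N -> (0 < m)%N -> (0 < r)%N -> (0 < R)%N -> (0 < theta)%N ->
    (r <= R)%N ->
    C * (n * m)%:R * log2 (2 * n * m)%:R <= theta%:R ->
  forall (gamma : K), 0 <= gamma <= 1 ->
  forall (f : cube n -> bool)
         (Lambdastar : trunc_box (n * m) R theta -> K), is_distr Lambdastar ->
  forall d : nat, (0 < d)%N ->
    ((d%:R)%:E <= (C^-1)%:E *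
       Order.min
         (Order.min ((m%:R)%:E * smooth_thrdeg f gamma)
                    ((Num.sqrt r%:R)%:E * smooth_thrdeg f gamma))
         ((theta%:R / (Num.sqrt r%:R * log2 (2 * n * m * R)%:R))%:E))%E ->
  exists Lambda : trunc_box (n * m) R theta -> K,
    [/\ is_distr Lambda,
        ((d%:R)%:E <= orth (@trunc_box_coord (n * m) R theta)
           (fun x => ((-1) ^+ comp_MPstar f (val x) * Lambda x)%R))%E
      & forall x,
          gamma * (C * (n * m * R)%:R) ^- (9 * d) * Lambdastar x <= Lambda x].
Proof.
(* $544=2\cdot16\cdot17$: half of $s\theta$ is kept in the tail exponent, $s=1/(16\sqrt r)$, and 17
   comes from [tail_times_bound]. *)
have [C [C544 smooth]] : exists C : K, 544 <= C /\ forall (X : K) (d : nat),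
    1 <= X -> (0 < d)%N -> 16 * (2 * (42 * 257 * X) ^+ d) <= (C * X) ^+ (9 * d).
  exists (2 ^+ 20); split; last exact: bound_times_smooth.
  apply: (@le_trans _ _ (2 ^+ 10)); first by rewrite -natrX ler_nat; lia.
  by rewrite ler_weXn2l // ler1n.
exists C; split; first by lra.
move=> n m r R theta n0 m0 r0 R0 _ rR hnm gamma /andP[g0 g1] f Ls Lsd d d0 hd.
have Cpos : 0 < C by lra.
move: hd; rewrite lee_pdivlMl // -EFinM !le_min => /andP[/andP[hdm hdr] hdt].
rewrite lee_fin in hdt.
have [k0 [l0 [l1 [k00 rk0 gl]]]] := exists_good_laws K r0 rR.
have C8 : 8 < C by lra.
have [mu [mud mus muo]] := smooth_witness m0 k00 d0 C8 rk0 hdm hdr.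
set q := Num.sqrt r%:R in rk0 hdt gl hdr.
have q1 : 1 <= q by rewrite -[leLHS]sqrtr1 ler_sqrt ?ler1n.
set s := (16 * q)^-1 in gl.
have s0 : 0 < s by rewrite invr_gt0; lra.
have nm1 : 1 <= (n * m)%:R :> K by rewrite ler1n muln_gt0 n0.
have tnm : 36 * (n * m)%:R <= theta%:R :> K.
  have C36 : 36 <= C by lra.
  apply: le_trans hnm; apply: (@le_trans _ _ (C * (n * m)%:R)).
    by apply: ler_wpM2r C36; apply: ler0n.
  rewrite ler_peMr //; first exact: mulr_ge0 (ltW Cpos) (ler0n _ _).
  by apply: log2_ge1; rewrite ler_nat -mulnA leq_pmulr // muln_gt0 n0.
set X : K := (n * m * R)%:R.
have X1 : 1 <= X by rewrite ler1n !muln_gt0 n0 m0.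
have tail : expR (18 * s * (n * m)%:R - s * theta%:R) *
    (2 * (42 * 257 * X) ^+ d) <= 1 / 4.
  have -> : 18 * s * (n * m)%:R - s * theta%:R =
     - (s * theta%:R - 18 * s * (n * m)%:R) by ring.
  apply: tail_times_bound => //.
  apply: (@le_trans _ _ (s * theta%:R / 2)); last first.
    by have := ler_wpM2l (ltW s0) tnm; clear; lra.
  have lnX : ln (2 * X) <= log2 (2 * n * m * R)%:R.
    have -> : (2 * n * m * R)%:R = 2 * X :> K by rewrite /X -natrM !mulnA.
    by apply: ln_le_log2; lra.
  set lg := log2 _ in lnX hdt.
  have lg0 : 0 < lg by apply: lt_le_trans lnX; rewrite ln_gt0 //; lra.
  have hdt' : C * d%:R * (q * lg) <= theta%:R.
    by rewrite -ler_pdivlMr // mulr_gt0 //; lra.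
  have sq : s * q = 1 / 16 by rewrite /s; field; lra.
  have h1 : s * (C * d%:R * (q * lg)) <= s * theta%:R.
    by rewrite ler_wpM2l // ltW.
  have e1 : s * (C * d%:R * (q * lg)) = C * (d%:R * lg) / 16.
    by transitivity (C * (d%:R * lg) * (s * q)); [ring | rewrite sq; field].
  have h2 : 544 * (d%:R * lg) <= C * (d%:R * lg).
    by rewrite ler_wpM2r // mulr_ge0 // ltW.
  have h3 : d%:R * ln (2 * X) <= d%:R * lg by rewrite ler_wpM2l.
  by lra.
have {}smooth := smooth X d X1 d0.
pose B : K := 2 * (42 * 257 * X) ^+ d.
have B1 : 1 <= B.
  rewrite -[leLHS]mulr1 ler_pM ?ler1n // exprn_ege1 //.
  rewrite -[leLHS]mulr1 ler_pM //; first by rewrite -natrM ler1n.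
pose eps : K := (C * X) ^- (9 * d).
have CX0 : 0 < (C * X) ^+ (9 * d) by rewrite exprn_gt0 // mulr_gt0 //; lra.
have eps0 : 0 <= eps by rewrite invr_ge0 ltW.
have epsB : eps * (16 * B) <= 1 by rewrite mulrC ler_pdivrMr // mul1r.
have del1 : 0 <= gamma * eps <= 1 / 2.
  rewrite mulr_ge0 //=; have h : gamma * eps <= eps by rewrite ler_piMl.
  have : eps * 16 <= eps * (16 * B) by rewrite ler_wpM2l //; lra.
  by lra.
have del01 : 0 <= gamma * eps <= 1 by case/andP: del1 => -> /= h; lra.
have mntheta : (n * m <= theta)%N by rewrite -(ler_nat K); lra.
rewrite -/X -/eps.
(* The monomials of degree less than [d]; each exponent fits in ['I_d], which makes the family
   finite. *)
pose J := {e : {ffun 'I_(n * m) -> 'I_d} | (\sum_t e t < d)%N}.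
pose ex (j : 'I_#|{: J}|) (t : 'I_(n * m)) : nat := val (enum_val j) t.
have ex_lt j : (\sum_t ex j t < d)%N by exact: valP (enum_val j).
pose sgn (x : trunc_box (n * m) R theta) : K := (-1) ^+ comp_MPstar f (val x).
pose u j x := sgn x * monomial K (ex j) (val x).
have [[Lam [Lamd Lamge Lamo]]|[c cP]] := gordan_smooth u Lsd del01.
  exists Lam; split=> //; apply: orth_ge => // p sp.
  have mo (e : multinom (n * m)) : e \in msupp p ->
      \sum_x sgn x * Lam x * monomial K e (val x) = 0.
    move=> ep; have ed : (\sum_t e t < d)%N.
      by rewrite -mdegE; apply: leq_trans (msize_mdeg_lt ep) sp.
    have et t : (e t < d)%N.
      by apply: leq_ltn_trans ed; rewrite (bigD1 t) //= leq_addr.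
    pose e0 : {ffun 'I_(n * m) -> 'I_d} := [ffun t => Ordinal (et t)].
    have he0 : (\sum_t e0 t < d)%N.
      by rewrite (eq_bigr (fun t => e t)) // => t _; rewrite ffunE.
    have := Lamo (enum_rank (exist _ e0 he0 : J)) => {2}<-.
    apply: eq_bigr => x _; rewrite /u mulrA [Lam x * _]mulrC; congr (_ * _).
    by apply: eq_bigr => t _; rewrite /ex enum_rankK /= ffunE.
  under eq_bigr do rewrite mevalE mulr_sumr; rewrite exchange_big /=.
  rewrite big_seq big1 // => e ep.
  by under eq_bigr do rewrite mulrCA; rewrite -mulr_sumr (mo e ep) mulr0.
(* The other alternative is a polynomial $P$ of degree less than $d$ such that, with $v=(-1)^FP$ and
   $\delta=\gamma(CnmR)^{-9d}$, $(1-\delta)v+\delta\sum_x\Lambda^*(x)v(x)$ is positive on the whole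
   truncated box. *)
exfalso.
pose w j := nest_exp (ex j) : 'I_n -> 'I_m -> nat.
have wlt j : (all_wd (w j) < d)%N by rewrite all_wd_nest.
pose P (z : {ffun 'I_n -> {ffun 'I_m -> 'I_R.+1}}) : K :=
  \sum_j c j * all_ev K (w j) z.
pose v (x : trunc_box (n * m) R theta) := sgn x * P (nest (val x)).
have vE x : \sum_j c j * u j x = v x.
  rewrite /v /P mulr_sumr; apply: eq_bigr => j _.
  by rewrite all_ev_nest mulrCA.
have vnorm x : `|v x| = `|P (nest (val x))|.
  by rewrite normrM normrX normrN1 expr1n mul1r.
have cv x : 0 < (1 - gamma * eps) * v x + gamma * eps * \sum_x' Ls x' * v x'.
  by have := cP x; rewrite vE; under eq_bigr do rewrite vE.
have tb (z : {ffun 'I_n -> {ffun 'I_m -> 'I_R.+1}}) : (weight_of z <= theta)%N ->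
    exists x : trunc_box (n * m) R theta, nest (val x) = z.
  move=> hz; have hx : (\sum_t unnest z t <= theta)%N by rewrite -weight_nest unnestK.
  by exists (exist _ (unnest z) hx); rewrite /= unnestK.
have patE x : f (pattern (nest x)) = @comp_MPstar n m R f x.
  by congr f; apply/ffunP => i; rewrite !ffunE.
have [x0 _] : exists x : trunc_box (n * m) R theta, nest (val x) = [ffun=> [ffun=> ord0]].
  by apply: tb; rewrite /weight_of big1 // => i _; rewrite big1 // => j _; rewrite !ffunE.
pose x1 := [arg min_(x < x0) v x]%O.
have x1P x : v x1 <= v x by rewrite /x1; case: arg_minP => // i _; apply.
(* The least $a\ge0$ with $v\ge-a$ on the truncated box. *)
pose a := Num.max 0 (- v x1).
have a0 : 0 <= a by rewrite le_max lexx.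
have psign z : (weight_of z <= theta)%N -> - a <= (-1) ^+ f (pattern z) * P z.
  move=> /tb[x <-]; rewrite patE -/(v x); apply: le_trans (x1P x).
  by rewrite lerNl le_max lexx orbT.
have small (y : trunc_box (n * m) R theta) : gamma * `|v y| <= B * (4 * a).
  rewrite vnorm.
  exact: (smooth_pointwise_bound n0 m0 R0 (ltW s0) gl wlt a0 psign tail mud g0 mus muo).
have [z ztheta hz] : exists2 z, (weight_of z <= theta)%N & `|P z| <= B * (4 * a).
  exact: (exists_small_point n0 m0 R0 (ltW s0) gl wlt a0 psign tail mud muo mntheta).
have [x2 x2z] := tb z ztheta.
have {hz x2z} vx2 : `|v x2| <= B * (4 * a) by rewrite vnorm x2z.
have [L0 L1] := Lsd.
have meanv : gamma * eps * \sum_x Ls x * v x <= a / 4.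
  apply: (@le_trans _ _ (eps * (B * (4 * a)))).
    rewrite [gamma * eps]mulrC -mulrA ler_wpM2l // mulr_sumr.
    apply: (@le_trans _ _ (\sum_x Ls x * (B * (4 * a)))).
      apply: ler_sum => x _; rewrite mulrCA ler_wpM2l //.
      by apply: le_trans (small x); rewrite ler_wpM2l // ler_norm.
    by rewrite -mulr_suml L1 mul1r.
  have := ler_wpM2r a0 epsB; clear; lra.
case/andP: del1 => _; move: (gamma * eps) meanv cv => del meanv cv del2.
(* If $v\ge0$, then $a=0$, so [v] vanishes at the small point [x2] while its mean is at most
   $a/4=0$, against [cv]. *)
have [v1|v1] := leP 0 (v x1).
  have a00 : a = 0 by apply/max_idPl; rewrite oppr_le0.
  move: vx2; rewrite a00 !mulr0 normr_le0 => /eqP vx2.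
  by have := cv x2; rewrite vx2 mulr0 add0r ltNge (le_trans meanv) // a00 mul0r.
(* Otherwise, at the minimum, the positive quantity is at most $-(1-\delta)a+a/4\le-a/4$, as
   $\delta\le1/2$. *)
have aE : a = - v x1 by apply/max_idPr; rewrite oppr_ge0 ltW.
have := cv x1; have : 0 <= (1 / 2 - del) * a by rewrite mulr_ge0 // subr_ge0.
have apos : 0 < a by rewrite aE oppr_gt0.
have -> : v x1 = - a by rewrite aE opprK.
by move: meanv apos; clear; lra.
Qed.
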